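(* Let $(\mu_c^*,\mu_s^* )\in\mathcal M_C\times\mathcal M_S$ be an optimal pair, i.e. $J(\mu_c^*,\mu_s^* )=\min_{(\mu_c,\mu_s)\in\mathcal M_C\times\mathcal M_S}J(\mu_c,\mu_s)$. Then the optimal control policy has the certainty-equivalence form $$u_k^*=\mu_c^*(I_C(k))=-\gamma\,\hat R^{-1}B^\top P A\,\hat x_k,\qquad \hat x_k=\mathbb E[x_k\mid I_C(k)],\qquad k\ge 0,$$ where $\hat R:=R+\gamma B^\top P B$ and $P\succeq 0$ is the unique positive semidefinite solution of the algebraic Riccati equation $$P=\gamma A^\top P A-\gamma^2A^\top P B\hat R^{-1}B^\top P A+Q .$$
   Context: Plant: $x_{k+1}=Ax_k+Bu_k+W_k$, $k\ge 0$, with $x_k\in\mathbb R^{n_x}$, $u_k\in\mathbb R^{n_u}$. The noises $W_k$ have zero mean and finite covariance $K_W$; the initial state $x_0$ has zero mean and finite covariance; $x_0$ and the $W_k$ are mutually independent (also across time). They need not be Gaussian. A scheduler chooses $a_k\in\{0,1\}$ at each time $k$; $a_k=1$ means that $x_k$ is transmitted to the controller at time $k$. Let $T_k$ be the (possibly random) set of times $s\le k$ with $a_s=1$. Write $[j]=\{0,1,\dots,j\}$. The information available to the controller at time $k$ is $I_C(k)=\{x_s,u_r\mid s\in T_k,\ r\in[k-1]\}$ and the information available to the scheduler at time $k$, when choosing $a_k$, is $I_S(k)=\{x_s,u_r,T_{k-1}\mid s\in[k],\ r\in[k-1]\}$, with $I_C(0)=I_S(0)=\emptyset$. $\mathcal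 M_C$ is the set of control policies $\mu_c$, $u_k=\mu_c(I_C(k))\in\mathbb R^{n_u}$, adapted to the sigma-field generated by $I_C$; $\mathcal M_S$ is the set of scheduling policies $\mu_s$, $a_k=\mu_s(I_S(k))\in\{0,1\}$, adapted to the sigma-field generated by $I_S$. Cost: $J(\mu_c,\mu_s)=\mathbb E\big[\sum_{k=0}^\infty\gamma^k(\|x_k\|_Q^2+\|u_k\|_R^2+\lambda a_k)\big]$, where $\|z\|_M^2=z^\top M z$, $Q\succeq 0$, $R\succ 0$, $\lambda>0$ and $\gamma\in(0,1)$. It is assumed that $(A,B)$ is controllable and $(A,Q^{1/2})$ is observable. *)

(* Defs.v *)
From HB Require Import structures.
From mathcomp Require Import all_boot all_order all_algebra.
From mathcomp Require Import all_classical all_reals all_analysis.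

Set Implicit Arguments.
Unset Strict Implicit.
Unset Printing Implicit Defensive.

Import Order.TTheory GRing.Theory Num.Theory.
Import numFieldNormedType.Exports.

Local Open Scope classical_set_scope.
Local Open Scope ring_scope.

(* Matrices and sequences carry the sigma-algebra generated by their entries
   (for 'cV[R]_n this is the Borel sigma-algebra of R^n). *)

Definition measure_matrix_display : measure_display -> measure_display.
Proof. exact. Qed.

Section measurable_matrix.
Context {d} {V : measurableType d} (m n : nat).

Definition matrix_entries : set (set 'M[V]_(m, n)) :=
  \bigcup_(ij in [set: 'I_m * 'I_n])
    preimage_set_system setT (fun M : 'M[V]_(m, n) => M ij.1 ij.2) measurable.

Let matrix_setC (A : set 'M[V]_(m, n)) :
  <<s matrix_entries >> A -> <<s matrix_entries >> (~` A).
Proof. exact: sigma_algebraC. Qed.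

HB.instance Definition _ := @isMeasurable.Build (measure_matrix_display d)
  'M[V]_(m, n) <<s matrix_entries >> (@sigma_algebra0 _ setT matrix_entries)
  matrix_setC (@sigma_algebra_bigcup _ setT matrix_entries).

End measurable_matrix.

Definition measure_seq_display : measure_display -> measure_display.
Proof. exact. Qed.

Section measurable_seq.
Context {d} {V : measurableType d}.

Definition seq_entries : set (set (nat -> V)) :=
  \bigcup_(s in [set: nat])
    preimage_set_system setT (fun f : nat -> V => f s) measurable.

Let seq_setC (A : set (nat -> V)) :
  <<s seq_entries >> A -> <<s seq_entries >> (~` A).
Proof. exact: sigma_algebraC. Qed.

HB.instance Definition _ := @isMeasurable.Build (measure_seq_display d)
  (nat -> V) <<s seq_entries >> (@sigma_algebra0 _ setT seq_entries)
  seq_setC (@sigma_algebra_bigcup _ setT seq_entries).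

End measurable_seq.

(* [option V] is the disjoint union of V and an isolated measurable point. *)

Definition measure_option_display : measure_display -> measure_display.
Proof. exact. Qed.

Section measurable_option.
Context {d} {V : measurableType d}.

Definition option_measurable : set (set (option V)) :=
  [set C | measurable (Some @^-1` C)].

Let option_set0 : option_measurable set0.
Proof. by rewrite /option_measurable /= preimage_set0; exact: measurable0. Qed.

Let option_setC C : option_measurable C -> option_measurable (~` C).
Proof.
by rewrite /option_measurable /= -preimage_setC => mC; exact: measurableC.
Qed.

Let option_bigcup (F : (set (option V))^nat) :
  (forall i, option_measurable (F i)) -> option_measurable (\bigcup_i F i).
Proof.
move=> mF; rewrite /option_measurable /= preimage_bigcup.
by apply: bigcup_measurable => i _; exact: mF.
Qed.

HB.instance Definition _ := isPointed.Build (option V) None.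
HB.instance Definition _ := @isMeasurable.Build (measure_option_display d)
  (option V) option_measurable option_set0 option_setC option_bigcup.

End measurable_option.

Section linear_quadratic.
Context {R : realType}.
Implicit Types n m p : nat.

Definition quad n (M : 'M[R]_n) (z : 'cV[R]_n) : R := (z^T *m M *m z) ord0 ord0.

Definition psd n (M : 'M[R]_n) : Prop := M^T = M /\ forall z, 0 <= quad M z.

Definition posdef n (M : 'M[R]_n) : Prop :=
  M^T = M /\ forall z, z != 0 -> 0 < quad M z.

Definition psd_sqrt_of n (Mh M : 'M[R]_n) : Prop := psd Mh /\ Mh *m Mh = M.

Fixpoint steer n m (A : 'M[R]_n) (B : 'M[R]_(n, m)) (u : nat -> 'cV[R]_m)
    (x : 'cV[R]_n) (k : nat) : 'cV[R]_n :=
  if k is j.+1 then A *m steer A B u x j + B *m u j else x.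

Definition controllable n m (A : 'M[R]_n) (B : 'M[R]_(n, m)) : Prop :=
  forall x y, exists (N : nat) (u : nat -> 'cV[R]_m), steer A B u x N = y.

Definition observable n p (A : 'M[R]_n) (C : 'M[R]_(p, n)) : Prop :=
  forall x y : 'cV[R]_n,
    (forall k : nat, C *m (A ^+ k *m x) = C *m (A ^+ k *m y)) -> x = y.

(* [Rc] is the control weight R of the cost, renamed because [R] is the field. *)
Definition Rhat n m (gamma : R) (B : 'M[R]_(n, m)) (Rc : 'M[R]_m)
    (P : 'M[R]_n) : 'M[R]_m := Rc + gamma *: (B^T *m P *m B).

Definition riccati n m (gamma : R) (A : 'M[R]_n) (B : 'M[R]_(n, m))
    (Q : 'M[R]_n) (Rc : 'M[R]_m) (P : 'M[R]_n) : Prop :=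
  P = gamma *: (A^T *m P *m A)
      - gamma ^+ 2 *: (A^T *m P *m B *m invmx (Rhat gamma B Rc P)
                         *m B^T *m P *m A)
      + Q.

End linear_quadratic.

Section closed_loop.
Context {R : realType} {nx nu : nat}.
Local Notation X := 'cV[R]_nx.
Local Notation U := 'cV[R]_nu.

(* Information sets are labelled data: the entry with index s is [None] when
   the corresponding item is not in the set.  In [sinfo] the last component is
   the indicator of the set of past transmission times. *)
Definition cinfo : Type := ((nat -> option X) * (nat -> option U))%type.
Definition sinfo : Type :=
  ((nat -> option X) * (nat -> option U) * (nat -> bool))%type.

(* The conjunct [0 < k] implements I_C(0) = I_S(0) = emptyset: a state x_0
   transmitted at time 0 is first available to the controller at time 1. *)
Definition info_C (x : nat -> X) (u : nat -> U) (a : nat -> bool) (k : nat) :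
    cinfo :=
  (fun s => if [&& (0 < k)%N, (s <= k)%N & a s] then Some (x s) else None,
   fun r => if (r < k)%N then Some (u r) else None).

Definition info_S (x : nat -> X) (u : nat -> U) (a : nat -> bool) (k : nat) :
    sinfo :=
  (fun s => if (0 < k)%N && (s <= k)%N then Some (x s) else None,
   fun r => if (r < k)%N then Some (u r) else None,
   fun s => (s < k)%N && a s).

Definition cpolicy : Type := nat -> cinfo -> U.
Definition spolicy : Type := nat -> sinfo -> bool.

Definition policies_C : set cpolicy :=
  [set mu | forall k, measurable_fun setT (mu k)].
Definition policies_S : set spolicy :=
  [set mu | forall k, measurable_fun setT (mu k)].

Variables (A : 'M[R]_nx) (B : 'M[R]_(nx, nu)) (mc : cpolicy) (ms : spolicy).

Section sample_path.
Variables (x0 : X) (w : nat -> X).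

Definition upd (V : Type) (f : nat -> V) (k : nat) (v : V) : nat -> V :=
  fun s => if s == k then v else f s.

(* The closed loop run for k steps: the returned sequences are meaningful for
   x_s with s <= k, and for u_s and a_s with s < k. *)
Fixpoint run (k : nat) : (nat -> X) * (nat -> U) * (nat -> bool) :=
  if k is j.+1 then
    let: (x, u, a) := run j in
    let a' := upd a j (ms j (info_S x u a j)) in
    let u' := upd u j (mc j (info_C x u a' j)) in
    (upd x j.+1 (A *m x j + B *m u' j + w j), u', a')
  else (fun=> x0, fun=> 0, fun=> false).

Definition state (k : nat) : X := (run k).1.1 k.
Definition control (k : nat) : U := (run k.+1).1.2 k.
Definition schedule (k : nat) : bool := (run k.+1).2 k.

Definition cinfo_at (k : nat) : cinfo := info_C state control schedule k.
Definition sinfo_at (k : nat) : sinfo := info_S state control schedule k.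

Lemma run_past k :
  [/\ forall s, (s <= k)%N -> (run k).1.1 s = state s,
      forall s, (s < k)%N -> (run k).1.2 s = control s
    & forall s, (s < k)%N -> (run k).2 s = schedule s].
Proof.
elim: k => [|k [IHx IHu IHa]].
  by split=> // s; rewrite leqn0 => /eqP ->.
split=> s; rewrite ?ltnS leq_eqVlt => /predU1P[->//|lt_s_k].
- rewrite -IHx //= ; case: (run k) => [[x u] a] /=.
  by rewrite /upd ltn_eqF.
- rewrite -IHu //= ; case: (run k) => [[x u] a] /=.
  by rewrite /upd ltn_eqF.
- rewrite -IHa //= ; case: (run k) => [[x u] a] /=.
  by rewrite /upd ltn_eqF.
Qed.

Lemma scheduleE k : schedule k = ms k (sinfo_at k).
Proof.
rewrite /schedule /=; have [Hx Hu Ha] := run_past k.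
case: (run k) Hx Hu Ha => [[x u] a] /= Hx Hu Ha.
rewrite /upd eqxx; congr (ms k _).
congr (_, _, _); apply/funext => s.
- by case: ifP => // /andP[_ /Hx ->].
- by case: ifP => // /Hu ->.
- by case: ltnP => //= /Ha ->.
Qed.

Lemma controlE k : control k = mc k (cinfo_at k).
Proof.
have sE : schedule k = (run k.+1).2 k by [].
rewrite /control /=; have [Hx Hu Ha] := run_past k.
move: sE => /=; case: (run k) Hx Hu Ha => [[x u] a] /= Hx Hu Ha sE.
rewrite /upd eqxx; congr (mc k _); congr (_, _); apply/funext => s; last first.
  by case: ifP => // /Hu ->.
have [|//] := ltnP 0%N k => k0 /=.
have [le_sk /=|//] := leqP s k; rewrite Hx //.
by move: le_sk; rewrite leq_eqVlt => /predU1P[->|lt_sk];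
  rewrite ?sE /upd ?eqxx // ltn_eqF // Ha.
Qed.

Lemma state0 : state 0 = x0. Proof. by []. Qed.

Lemma stateS k : state k.+1 = A *m state k + B *m control k + w k.
Proof.
rewrite /state /control /=; case: (run k) => [[x u] a] /=.
by rewrite /upd !eqxx.
Qed.

End sample_path.

Definition path_cost (Q : 'M[R]_nx) (Rc : 'M[R]_nu) (gamma lambda : R)
    (x0 : X) (w : nat -> X) : \bar R :=
  (\sum_(0 <= k <oo)
    (gamma ^+ k * (quad Q (state x0 w k) + quad Rc (control x0 w k)
                   + lambda * (schedule x0 w k)%:R))%:E)%E.

End closed_loop.

Arguments cinfo : clear implicits.
Arguments sinfo : clear implicits.
Arguments cpolicy : clear implicits.
Arguments spolicy : clear implicits.

Section stochastic.
Context {d : measure_display} {T : measurableType d} {R : realType}.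
Variable Pr : probability T R.

Definition centered_with_covariance n (Z : T -> 'cV[R]_n) (K : 'M[R]_n) : Prop :=
  (forall i, (fun w => Z w i ord0) \in Lfun Pr 2%:E) /\
  (forall i, ('E_Pr[fun w => Z w i ord0] = 0)%E) /\
  (forall i j, covariance Pr (fun w => Z w i ord0) (fun w => Z w j ord0)
               = (K i j)%:E).

Definition mutually_independent {d'} {V : measurableType d'} (I : eqType)
    (Z : I -> T -> V) : Prop :=
  forall (s : seq I) (E : I -> set V), uniq s ->
    (forall i, i \in s -> measurable (E i)) ->
    Pr (\bigcap_(i in [set` s]) (Z i @^-1` E i))
    = (\prod_(i <- s) Pr (Z i @^-1` E i))%E.

(* Y is a version of the (entrywise) conditional expectation E[Z | G]. *)
Definition is_condexp n (G : set (set T)) (Z Y : T -> 'cV[R]_n) : Prop :=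
  [/\ forall i, Pr.-integrable setT (fun w => (Z w i ord0)%:E),
      forall i, Pr.-integrable setT (fun w => (Y w i ord0)%:E),
      forall E, measurable E -> G (Y @^-1` E)
    & forall i S, G S ->
        (\int[Pr]_(w in S) (Y w i ord0)%:E
         = \int[Pr]_(w in S) (Z w i ord0)%:E)%E].

Section expected_cost.
Context {nx nu : nat}.
Variables (A : 'M[R]_nx) (B : 'M[R]_(nx, nu)) (Q : 'M[R]_nx) (Rc : 'M[R]_nu).
Variables (gamma lambda : R).
Variables (x0 : T -> 'cV[R]_nx) (W : nat -> T -> 'cV[R]_nx).

Definition J (mc : cpolicy R nx nu) (ms : spolicy R nx nu) : \bar R :=
  (\int[Pr]_w path_cost A B mc ms Q Rc gamma lambda (x0 w) (W ^~ w))%E.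

Definition optimal_pair (mc : cpolicy R nx nu) (ms : spolicy R nx nu) : Prop :=
  [/\ policies_C mc, policies_S ms
    & forall mc' ms', policies_C mc' -> policies_S ms' ->
        (J mc ms <= J mc' ms')%E].

End expected_cost.

End stochastic.

(* Main.v *)
Require Import Defs.
From HB Require Import structures.
From mathcomp Require Import all_boot all_order all_algebra.
From mathcomp Require Import all_classical all_reals all_analysis.
From mathcomp Require Import measurable_realfun.
From mathcomp Require Import ring lra.

Set Implicit Arguments.
Unset Strict Implicit.
Unset Printing Implicit Defensive.

Import Order.TTheory GRing.Theory Num.Theory.
Import numFieldNormedType.Exports.

Local Open Scope classical_set_scope.
Local Open Scope ring_scope.

(* The proof is variational.  Fix a time k, an event on which the controller's
   information at time k lies in a measurable set E, and a vector v.  On that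
   event move the control by v at time k and by -L times the resulting state
   deviation xi afterwards, where L is the Riccati gain.  The deviations are
   deterministic, so both agents can subtract them from their data and keep
   running the original policies: the transmission times do not change, and no
   dual effect of the control appears.  By the polarized completion of squares
   the change of the discounted cost up to a horizon N telescopes to
     g^k (2 <u_k + L x_k, v>_H + |v|_H^2)  on the event, with H = Rhat,
   plus terms linear in the noises W_j, j >= k, which have mean zero because
   W_j is independent of the information at time k, plus a boundary term at
   most g^N |x_N|_P^2.  Observability bounds |x_N|_P^2 by finitely many stage
   costs and noises, so the mean of the boundary term tends to 0 whenever the
   cost is finite, and it is finite for an optimal pair since a stabilizing
   linear feedback with permanent transmission has finite cost.
   Replacing v by s v and letting s vary, optimality gives
   E[(u_k + L x_k) 1_E(I_C(k))] = 0 for every E, i.e. u_k = -L E[x_k | I_C(k)]. *)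

(** * Quadratic forms and completion of squares *)

(** The event must be one that both agents recognize later on. The controller's data only grow, and
    the data of the scheduler at a time j > k contain the states and transmission times up to k,
    hence I_C(k); this is why E is a set of values of the controller's information. Before that the
    deviations vanish, so the outcome of the test does not matter.

    All estimates are made at a finite horizon, because the perturbed pair is not known to have
    finite cost. Only an upper bound on its cost is required, so the boundary term can be bounded
    along the original path alone. Square integrability of the controls comes from finite cost and R
    > 0; that of the states comes from the dynamics, since Q may be degenerate.

    P is the monotone limit of value iteration started at 0, bounded because controllability
    provides a control that steers to the origin at finite cost. Its uniqueness rests on the same
    observability estimate as the vanishing of the boundary term. *)

Section bilinear.
Context {R : realType}.

Definition bl n m (M : 'M[R]_(n, m)) (y : 'cV[R]_n) (z : 'cV[R]_m) : R :=
  (y^T *m M *m z) ord0 ord0.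

Lemma quadE n (M : 'M[R]_n) z : quad M z = bl M z z.
Proof. by []. Qed.

Lemma blDl n m (M : 'M[R]_(n, m)) y y' z :
  bl M (y + y') z = bl M y z + bl M y' z.
Proof. by rewrite /bl linearD /= !mulmxDl mxE. Qed.

Lemma blDr n m (M : 'M[R]_(n, m)) y z z' :
  bl M y (z + z') = bl M y z + bl M y z'.
Proof. by rewrite /bl mulmxDr mxE. Qed.

Lemma blZl n m (M : 'M[R]_(n, m)) c y z : bl M (c *: y) z = c * bl M y z.
Proof. by rewrite /bl linearZ /= -!scalemxAl mxE. Qed.

Lemma blZr n m (M : 'M[R]_(n, m)) c y z : bl M y (c *: z) = c * bl M y z.
Proof. by rewrite /bl -scalemxAr mxE. Qed.

Lemma blNl n m (M : 'M[R]_(n, m)) y z : bl M (- y) z = - bl M y z.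
Proof. by rewrite -scaleN1r blZl mulN1r. Qed.

Lemma blNr n m (M : 'M[R]_(n, m)) y z : bl M y (- z) = - bl M y z.
Proof. by rewrite -scaleN1r blZr mulN1r. Qed.

Lemma bl0l n m (M : 'M[R]_(n, m)) z : bl M 0 z = 0.
Proof. by rewrite -(scale0r 0) blZl mul0r. Qed.

Lemma bl0r n m (M : 'M[R]_(n, m)) y : bl M y 0 = 0.
Proof. by rewrite -(scale0r 0) blZr mul0r. Qed.

Lemma blDM n m (M N : 'M[R]_(n, m)) y z : bl (M + N) y z = bl M y z + bl N y z.
Proof. by rewrite /bl mulmxDr mulmxDl mxE. Qed.

Lemma blZM n m (M : 'M[R]_(n, m)) c y z : bl (c *: M) y z = c * bl M y z.
Proof. by rewrite /bl -scalemxAr -scalemxAl mxE. Qed.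

Lemma blNM n m (M : 'M[R]_(n, m)) y z : bl (- M) y z = - bl M y z.
Proof. by rewrite -scaleN1r blZM mulN1r. Qed.

Lemma bl_mull n n' m (M : 'M[R]_(n, m)) (A : 'M[R]_(n, n')) y z :
  bl M (A *m y) z = bl (A^T *m M) y z.
Proof. by rewrite /bl trmx_mul !mulmxA. Qed.

Lemma bl_mulr n m m' (M : 'M[R]_(n, m)) (A : 'M[R]_(m, m')) y z :
  bl M y (A *m z) = bl (M *m A) y z.
Proof. by rewrite /bl !mulmxA. Qed.

Lemma bl_tr n m (M : 'M[R]_(n, m)) y z : bl M y z = bl M^T z y.
Proof.
have : ((y^T *m M *m z)^T) ord0 ord0 = (z^T *m M^T *m y) ord0 ord0.
  by rewrite !trmx_mul trmxK mulmxA.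
by rewrite mxE.
Qed.

Lemma blC n (M : 'M[R]_n) y z : M^T = M -> bl M y z = bl M z y.
Proof. by move=> sM; rewrite bl_tr sM. Qed.

Lemma bl_delta n m (M : 'M[R]_(n, m)) i j :
  bl M (delta_mx i ord0) (delta_mx j ord0) = M i j.
Proof.
rewrite /bl trmx_delta -rowE mxE (bigD1 j) //= big1 => [|j' nj].
  by rewrite !mxE !eqxx mulr1 addr0.
by rewrite !mxE (negbTE nj) mulr0.
Qed.

Lemma blE n m (M : 'M[R]_(n, m)) y z :
  bl M y z = \sum_i \sum_j M i j * y i ord0 * z j ord0.
Proof.
rewrite /bl mxE exchange_big /=; apply: eq_bigr => j _.
rewrite mxE mulr_suml; apply: eq_bigr => i _; rewrite mxE; ring.
Qed.

Lemma quadD n (M : 'M[R]_n) y z : M^T = M ->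
  quad M (y + z) = quad M y + 2 * bl M y z + quad M z.
Proof. by move=> sM; rewrite !quadE !blDl !blDr (blC z y sM); ring. Qed.

(** Polarization at pairs of basis vectors recovers every entry. *)
Lemma quad_inj n (M N : 'M[R]_n) : M^T = M -> N^T = N ->
  (forall z, quad M z = quad N z) -> M = N.
Proof.
move=> sM sN MN; apply/matrixP => i j; rewrite -!bl_delta.
set a := delta_mx i _; set b := delta_mx j _.
have := MN (a + b); rewrite !quadD // !MN; lra.
Qed.

Lemma psd_posdef n (M : 'M[R]_n) : posdef M -> psd M.
Proof.
case=> sM pM; split=> // z; have [->|/pM/ltW//] := eqVneq z 0.
by rewrite quadE bl0l.
Qed.

Lemma posdefD n (M N : 'M[R]_n) : posdef M -> psd N -> posdef (M + N).
Proof.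
move=> [sM pM] [sN pN]; split; first by rewrite linearD /= sM sN.
by move=> z z0; rewrite quadE blDM ltr_wpDr ?pM ?pN.
Qed.

Lemma psd_congr n m (M : 'M[R]_n) (C : 'M[R]_(n, m)) c : psd M -> 0 <= c ->
  psd (c *: (C^T *m M *m C)).
Proof.
move=> [sM pM] c0; split.
  by rewrite linearZ /= !trmx_mul trmxK sM mulmxA.
move=> z; rewrite quadE blZM -bl_mulr -bl_mull mulr_ge0 //; exact: pM.
Qed.

Lemma quad1E n (z : 'cV[R]_n) : quad 1%:M z = \sum_i z i ord0 ^+ 2.
Proof.
by rewrite quadE /bl mulmx1 mxE; apply: eq_bigr => i _; rewrite mxE expr2.
Qed.

Lemma posdef1 n : posdef (1%:M : 'M[R]_n).
Proof.
split=> [|z z0]; first by rewrite trmx1.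
rewrite quad1E lt_def sumr_ge0 ?andbT => [|i _]; last exact: sqr_ge0.
apply: contra_neq z0 => /eqP; rewrite psumr_eq0 => [/allP z0|i _].
  apply/matrixP => i j; rewrite ord1 mxE.
  by have /eqP := z0 i (mem_index_enum _); move=> /eqP; rewrite sqrf_eq0 => /eqP.
exact: sqr_ge0.
Qed.

Lemma posdef_unit n (M : 'M[R]_n) : posdef M -> M \in unitmx.
Proof.
move=> [sM pM]; rewrite -row_free_unit -kermx_eq0; apply/rowV0P => v.
move=> /sub_kermxP vM; apply: contrapT => /eqP v0.
have : v^T != 0 by apply: contra_neq v0 => h; rewrite -[v]trmxK h trmx0.
by move=> /pM; rewrite quadE /bl trmxK vM mul0mx mxE ltxx.
Qed.

(* Cauchy-Schwarz in the inner product of M, applied to u and the vector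
   representing the i-th coordinate. *)
Lemma sqr_coord_le n (M : 'M[R]_n) (i : 'I_n) : posdef M ->
  exists2 c : R, 0 <= c & forall u : 'cV[R]_n, u i ord0 ^+ 2 <= c * quad M u.
Proof.
move=> pdM; have uM := posdef_unit pdM; have [sM pM] := psd_posdef pdM.
pose v := invmx M *m delta_mx i ord0 : 'cV[R]_n.
exists (quad M v + 1) => [|u]; first by rewrite addr_ge0 ?pM.
have uv : bl M u v = u i ord0.
  rewrite bl_mulr mulmxV // /bl mulmx1 mxE (bigD1 i) //= big1 => [|j ji].
    by rewrite !mxE !eqxx mulr1 addr0.
  by rewrite !mxE (negbTE ji) mulr0.
set q := quad M v; have q0 : 0 <= q by exact: pM.
(* With t = u_i and s = |u|_M^2, nonnegativity at this vector says (q + 2) t^2 <= (q + 1)^2 s. The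
   weight q + 1 in place of q stays positive whatever q is. *)
have := pM ((q + 1) *: u + (- u i ord0) *: v); rewrite quadD //.
rewrite blZl blZr uv !quadE !(blZl, blZr) -!quadE -/q.
set t := u i ord0; set s := quad M u => h.
have : (q + 1) * t ^+ 2 <= (q + 1) * ((q + 1) * s).
  apply: le_trans (_ : (q + 2) * t ^+ 2 <= _).
    by apply: ler_wpM2r; [exact: sqr_ge0|lra].
  move: h; set a := _ + _ => h.
  have -> : (q + 2) * t ^+ 2 = (q + 1) * ((q + 1) * s) - a by rewrite /a; ring.
  lra.
by rewrite ler_pM2l // ltr_wpDl.
Qed.

Lemma quad_le_coord n (M : 'M[R]_n) (z : 'cV[R]_n) :
  quad M z <= (\sum_i \sum_j `|M i j|) * \sum_i z i ord0 ^+ 2.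
Proof.
rewrite quadE blE mulr_suml; apply: ler_sum => i _.
rewrite mulr_suml; apply: ler_sum => j _; set s := \sum_i _.
have s0 (a : 'I_n) : z a ord0 ^+ 2 <= s.
  by rewrite /s (bigD1 a) //= lerDl sumr_ge0 // => b _; exact: sqr_ge0.
apply: le_trans (ler_norm _) _; rewrite -mulrA normrM ler_wpM2l // normrM.
have := s0 i; have := s0 j.
rewrite -(real_normK (num_real (z i ord0))) -(real_normK (num_real (z j ord0))).
have := sqr_ge0 (`|z i ord0| - `|z j ord0|).
set a := `|_|; set b := `|z j ord0|; nra.
Qed.

(** Adds up the coordinate bounds of [sqr_coord_le]. The comparison constants of the observability
    and Lyapunov estimates come from here. *)
Lemma quad_le n (M N : 'M[R]_n) : posdef N ->
  exists2 c : R, 0 <= c & forall z, quad M z <= c * quad N z.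
Proof.
move=> pN; have [_ qN] := psd_posdef pN.
have cP i := sqr_coord_le i pN.
pose c i := sval (cid2 (cP i)).
have c0 i : 0 <= c i by rewrite /c; case: cid2.
have cE i (u : 'cV[R]_n) : u i ord0 ^+ 2 <= c i * quad N u by rewrite /c; case: cid2.
exists ((\sum_i \sum_j `|M i j|) * \sum_i c i) => [|z].
  by rewrite mulr_ge0 ?sumr_ge0 // => i _; rewrite sumr_ge0.
apply: le_trans (quad_le_coord _ _) _; rewrite -mulrA ler_wpM2l //.
  by rewrite sumr_ge0 // => i _; rewrite sumr_ge0.
by rewrite mulr_suml; exact: ler_sum.
Qed.

End bilinear.

Section riccati_step.
Context {R : realType} {n m : nat}.
Variables (g : R) (A : 'M[R]_n) (B : 'M[R]_(n, m)) (Q : 'M[R]_n) (Rc : 'M[R]_m).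
Hypotheses (g0 : 0 <= g) (hR : posdef Rc).

(** The right-hand side as an operator, shared by value iteration and the equation: [riccati]
    unfolds to the fixed-point equation of this map, which the casts of [esym rP] below exploit. *)
Definition riccati_map (P : 'M[R]_n) : 'M[R]_n :=
  g *: (A^T *m P *m A)
      - g ^+ 2 *: (A^T *m P *m B *m invmx (Rhat g B Rc P)
                         *m B^T *m P *m A)
      + Q.

Definition gain (P : 'M[R]_n) : 'M[R]_(m, n) :=
  g *: (invmx (Rhat g B Rc P) *m B^T *m P *m A).

Lemma posdef_Rhat P : psd P -> posdef (Rhat g B Rc P).
Proof. by move=> pP; apply: posdefD => //; exact: psd_congr. Qed.

Lemma riccati_bl P x xi u de : psd P ->
  bl Q x xi + bl Rc u de + g * bl P (A *m x + B *m u) (A *m xi + B *m de)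
  = bl (riccati_map P) x xi
    + bl (Rhat g B Rc P) (u + gain P *m x) (de + gain P *m xi).
Proof.
move=> pP; have pH := posdef_Rhat pP.
have uH := posdef_unit pH; have [sH _] := pH; have [sP _] := pP.
set H := Rhat g B Rc P in pH uH sH *.
have HL : H *m gain P = g *: (B^T *m P *m A).
  by rewrite /gain -/H -scalemxAr !mulmxA mulmxV // mul1mx.
have LH : (gain P)^T *m H = g *: (A^T *m P *m B).
  by rewrite -[LHS]trmxK trmx_mul trmxK sH HL linearZ /= !trmx_mul trmxK sP mulmxA.
have HE : bl H u de = bl Rc u de + g * bl (B^T *m P *m B) u de.
  by rewrite /H /Rhat blDM blZM.
rewrite (blDl H) !(blDr H) HE.
rewrite !(bl_mull H (gain P)) !(bl_mulr H (gain P)) LH HL.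
rewrite (bl_mulr (_ *: _) (gain P)).
have -> : g *: (A^T *m P *m B) *m gain P = g ^+ 2 *: (A^T *m P *m B *m invmx H
                         *m B^T *m P *m A).
  by rewrite /gain -/H -scalemxAl -scalemxAr scalerA -expr2 !mulmxA.
rewrite /riccati_map -/H !blDM blNM !blZM.
rewrite blDl !blDr !bl_mull !bl_mulr ?mulmxA; ring.
Qed.

Lemma riccati_quad P x u : psd P ->
  quad Q x + quad Rc u + g * quad P (A *m x + B *m u)
  = quad (riccati_map P) x + quad (Rhat g B Rc P) (u + gain P *m x).
Proof. by move=> pP; rewrite !quadE riccati_bl. Qed.

(** Bellman inequality; [riccati_quad_gain] is the case of equality, at u = - L x. *)
Lemma riccati_quad_le P x u : psd P ->
  quad (riccati_map P) x <= quad Q x + quad Rc u + g * quad P (A *m x + B *m u).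
Proof.
move=> pP; rewrite riccati_quad // lerDl.
by have [_] := psd_posdef (posdef_Rhat pP).
Qed.

Lemma riccati_quad_gain P x : psd P ->
  quad (riccati_map P) x = quad Q x + quad Rc (- (gain P *m x))
    + g * quad P (A *m x - B *m gain P *m x).
Proof.
move=> pP; have := riccati_quad x (- (gain P *m x)) pP.
by rewrite addNr (quadE _ 0) bl0l addr0 mulmxN mulmxA => ->.
Qed.

End riccati_step.

(** * Observability *)

Section observability.
Context {R : realType} {n m : nat}.
Variables (A : 'M[R]_n) (B : 'M[R]_(n, m)) (Q Qh : 'M[R]_n) (Rc : 'M[R]_m).
Hypotheses (hR : posdef Rc) (hQ : psd Q).
Hypotheses (hQh : psd_sqrt_of Qh Q) (hAQ : observable A Qh).

(** Cauchy-Schwarz for a possibly degenerate form: with b = <y, z>_M, the test vector below has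
    energy - (q + 2) b^2, which forces b = 0 for every y. *)
Lemma psd_quad_eq0 (M : 'M[R]_n) z : psd M -> quad M z = 0 -> M *m z = 0.
Proof.
move=> [sM pM] qz.
have b0 y : bl M y z = 0.
  set q := quad M y; set b := bl M y z.
  have q0 : 0 <= q by exact: pM.
  have q1 : q + 1 != 0 by rewrite gt_eqF // ltr_wpDl.
  have := pM (- b *: y + (q + 1) *: z).
  rewrite quadD // blZl blZr -/b !quadE !(blZl, blZr) -!quadE qz -/q => h.
  apply/eqP; rewrite -sqrf_eq0 eq_le sqr_ge0 andbT.
  have := sqr_ge0 b; nra.
apply/matrixP => i j; rewrite ord1 [RHS]mxE -(b0 (delta_mx i ord0)).
by rewrite /bl trmx_delta -mulmxA -rowE !mxE.
Qed.

Lemma psd_quadD_le p (M : 'M[R]_p) y z : psd M ->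
  quad M (y + z) <= 2 * quad M y + 2 * quad M z.
Proof.
move=> [sM pM]; have := pM (y - z).
by rewrite !quadD // blNr (quadE M (- z)) blNl blNr opprK -quadE; lra.
Qed.

(** The observability Gramian, the sum of (A^T)^i Q A^i over i < k, with the first step peeled off
    to match one step of the dynamics. *)
Fixpoint obs_gram (k : nat) : 'M[R]_n :=
  if k is j.+1 then Q + A^T *m obs_gram j *m A else 0.

Lemma obs_gramS k z :
  quad (obs_gram k.+1) z = quad Q z + quad (obs_gram k) (A *m z).
Proof. by rewrite !quadE /= blDM -bl_mulr -bl_mull. Qed.

Lemma psd0 p : psd (0 : 'M[R]_p).
Proof. by split=> [|z]; rewrite ?trmx0 // quadE /bl /= mulmx0 mul0mx mxE. Qed.

Lemma psd_obs_gram k : psd (obs_gram k).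
Proof.
elim: k => [|k [sk pk]]; first exact: psd0.
split=> [|z]; last by rewrite obs_gramS addr_ge0 ?(proj2 hQ).
by rewrite /= linearD /= !trmx_mul trmxK sk (proj1 hQ) mulmxA.
Qed.

(** The form is the sum of the squared norms of the outputs Qh A^j z, so each of them vanishes. *)
Lemma obs_gram_eq0 k z : quad (obs_gram k) z = 0 ->
  forall j, (j < k)%N -> Qh *m (A ^+ j *m z) = 0.
Proof.
elim: k z => // k IH z; rewrite obs_gramS => /eqP.
rewrite paddr_eq0; [|exact: (proj2 hQ)|exact: (proj2 (psd_obs_gram k))].
move=> /andP[/eqP Qz /eqP Gz] [_|j ltjk]; last first.
  by rewrite exprSr -mulmxA; exact: IH.
rewrite expr0 mul1mx; move: Qz; have [[sQ pQ] <-] := hQh.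
have -> : quad (Qh *m Qh) z = quad 1%:M (Qh *m z).
  by rewrite !quadE bl_mull bl_mulr sQ mulmx1.
move=> Qz; apply/eqP; apply: contraPT Qz => nz; apply/eqP.
by rewrite gt_eqF // (proj2 (posdef1 _)).
Qed.

Lemma obs_gramW k l z : (k <= l)%N -> quad (obs_gram l) z = 0 ->
  quad (obs_gram k) z = 0.
Proof.
elim: k l z => [|k IH] l z; first by move=> _ _; rewrite quadE /bl /= mulmx0 mul0mx mxE.
case: l => // l le_kl; rewrite !obs_gramS => /eqP.
rewrite paddr_eq0; [|exact: (proj2 hQ)|exact: (proj2 (psd_obs_gram l))].
by move=> /andP[/eqP -> /eqP /(IH _ _ le_kl) ->]; rewrite addr0.
Qed.

Lemma obs_gram_kermx k l : (k <= l)%N ->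
  (kermx (obs_gram l) <= kermx (obs_gram k))%MS.
Proof.
move=> le_kl; apply/rV_subP => v /sub_kermxP vG; apply/sub_kermxP.
have sG j := proj1 (psd_obs_gram j).
have : quad (obs_gram l) v^T = 0 by rewrite quadE /bl trmxK vG mul0mx mxE.
move=> /(obs_gramW le_kl) /(psd_quad_eq0 (psd_obs_gram k)).
by move=> /(congr1 trmx); rewrite trmx_mul trmxK sG trmx0.
Qed.

(* The kernels of the Gramians decrease, so they are constant from the index
   of maximal rank on; the common kernel is trivial by observability. *)
Lemma obs_gram_posdef : exists k, posdef (obs_gram k).
Proof.
pose Pr r := `[< exists k, \rank (obs_gram k) = r >].
have exP : exists r, Pr r by exists (\rank (obs_gram 0)); apply/asboolP; exists 0%N.
have leP r : Pr r -> (r <= n)%N by move=> /asboolP[k <-]; exact: rank_leq_row.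
case: (ex_maxnP exP leP) => r /asboolP[k rk] maxr.
have [sk pk] := psd_obs_gram k.
exists k; split=> // z z0; rewrite lt_def pk andbT.
apply: contra_neq z0 => qz; apply: hAQ => j; rewrite !mulmx0.
apply: (@obs_gram_eq0 (maxn k j.+1)); last by rewrite leq_max ltnSn orbT.
set l := maxn _ _; have le_kl : (k <= l)%N by exact: leq_maxl.
have kl := obs_gram_kermx le_kl.
have kz : (z^T <= kermx (obs_gram k))%MS.
  by apply/sub_kermxP; rewrite -[obs_gram k]sk -trmx_mul psd_quad_eq0 ?trmx0.
have : (kermx (obs_gram k) <= kermx (obs_gram l))%MS.
  rewrite -(mxrank_leqif_sup kl) eqn_leq mxrankS //= !mxrank_ker rk leq_sub2l //.
  by apply: maxr; apply/asboolP; exists l.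
move=> /(submx_trans kz) /sub_kermxP zl.
by rewrite quadE /bl zl mul0mx mxE.
Qed.

(** The noise is counted because the outputs after time N determine x_N only up to the inputs and
    noises that act meanwhile. *)
Definition stage_energy (x : nat -> 'cV[R]_n) (u : nat -> 'cV[R]_m)
    (w : nat -> 'cV[R]_n) j : R :=
  quad Q (x j) + quad Rc (u j) + quad 1%:M (w j).

Lemma stage_energy_ge0 x u w j : 0 <= stage_energy x u w j.
Proof.
by rewrite /stage_energy !addr_ge0 ?(proj2 hQ) ?(proj2 (psd_posdef hR))
  ?(proj2 (psd_posdef (posdef1 _))).
Qed.

(** Induction on the window length: A x_N is x_{N+1} minus the input and the noise of step N, so the
    shorter Gramian at A x_N reduces to the one at x_{N+1}. The window lies after N, which is what
    makes it a tail of the cost. *)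
Lemma obs_gram_bound k : exists2 C : R, 0 <= C & forall x u w,
  (forall j, x j.+1 = A *m x j + B *m u j + w j) ->
  forall N, quad (obs_gram k) (x N)
    <= C * \sum_(j < k) stage_energy x u w (N + j).
Proof.
elim: k => [|k [C C0 IH]].
  by exists 0 => // x u w _ N; rewrite quadE /bl /= mulmx0 mul0mx mxE mul0r.
have [c1 c10 h1] := quad_le (B^T *m obs_gram k *m B) hR.
have [c2 c20 h2] := quad_le (obs_gram k) (posdef1 (R := R) n).
(* 1 pays for Q at x_N, the factor 2 for splitting A x_N, and the factor 4 for splitting the
   remainder once more into input and noise. *)
exists (1 + 2 * C + 4 * c1 + 4 * c2) => [|x u w dyn N]; first by lra.
have pk := psd_obs_gram k.
rewrite obs_gramS.
have -> : A *m x N = x N.+1 + - (B *m u N + w N).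
  by rewrite dyn -[_ + B *m _ + _]addrA addrK.
have := psd_quadD_le (x N.+1) (- (B *m u N + w N)) pk.
rewrite [quad _ (- _)]quadE blNl blNr opprK -quadE.
have := psd_quadD_le (B *m u N) (w N) pk.
rewrite [quad _ (B *m u N)]quadE bl_mulr bl_mull mulmxA -quadE.
have := h1 (u N); have := h2 (w N); have := IH x u w dyn N.+1.
rewrite big_ord_recl /= addn0.
have -> : \sum_(i < k) stage_energy x u w (N + bump 0 i)
  = \sum_(i < k) stage_energy x u w (N.+1 + i).
  by apply: eq_bigr => i _; rewrite /bump /= add1n addnS.
set S := \sum_(i < _) _.
have S0 : 0 <= S by rewrite sumr_ge0 // => i _; exact: stage_energy_ge0.
clearbody S; rewrite /stage_energy.
have := proj2 hQ (x N); have := proj2 (psd_posdef hR) (u N).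
have := proj2 (psd_posdef (posdef1 _)) (w N).
move: (quad Q _) (quad Rc _) (quad 1%:M _) => a b c c0 b0 a0.
move: (quad _ _) (quad _ _) (quad _ _) (quad _ _) (quad _ _).
move=> t1 t2 t3 t4 t5 e1 e2 e3 e4 e5.
have := mulr_ge0 c10 S0; have := mulr_ge0 c20 S0; have := mulr_ge0 C0 S0.
have := mulr_ge0 c10 a0; have := mulr_ge0 c10 c0; have := mulr_ge0 c10 b0.
have := mulr_ge0 c20 a0; have := mulr_ge0 c20 c0; have := mulr_ge0 c20 b0.
have := mulr_ge0 C0 a0; have := mulr_ge0 C0 c0; have := mulr_ge0 C0 b0.
nra.
Qed.

Lemma obs_bound (P : 'M[R]_n) : exists k, exists2 C : R, 0 <= C &
  forall x u w, (forall j, x j.+1 = A *m x j + B *m u j + w j) ->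
  forall N, quad P (x N) <= C * \sum_(j < k) stage_energy x u w (N + j).
Proof.
have [k pk] := obs_gram_posdef; exists k.
have [C C0 hC] := obs_gram_bound k; have [c c0 hc] := quad_le P pk.
exists (c * C) => [|x u w dyn N]; first exact: mulr_ge0.
by apply: le_trans (hc _) _; rewrite -mulrA ler_wpM2l // hC.
Qed.

End observability.

(** * Vanishing discounted tails *)

Section discounted_tail.
Context {R : realType}.

(** Bounded partial sums make g^N e_N tend to 0, and p_N is controlled by a window of fixed length
    k. The constant D leaves room for the noise energy, which does not decay but is discounted. *)
Lemma discounted_tail_cvg0 (g : R) (p e : nat -> R) (C D : R) k :
  0 < g < 1 -> (forall N, 0 <= p N) -> (forall j, 0 <= e j) ->
  (exists K, forall N, \sum_(j < N) g ^+ j * e j <= K) ->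
  (forall N, p N <= C * \sum_(j < k) (e (N + j)%N + D)) ->
  (fun N => g ^+ N * p N) @ \oo --> (0 : R).
Proof.
move=> /andP[g0 g1] p0 e0 [K hK] hp.
have gn0 j : g ^+ j != 0 by rewrite expf_neq0 // gt_eqF.
have e_cvg : (fun N => g ^+ N * e N) @ \oo --> (0 : R).
  apply: cvg_series_cvg_0; apply: nondecreasing_is_cvgn.
    apply/nondecreasing_seqP => N; rewrite seriesSr lerDl.
    by rewrite mulr_ge0 // exprn_ge0 // ltW.
  exists K => _ [N _ <-]; rewrite /series /= big_mkord; exact: hK.
have g_cvg : (fun N => g ^+ N) @ \oo --> (0 : R).
  by apply: cvg_expr; rewrite ger0_norm // ltW.
(* The shift inside the window costs a factor g^-j, harmless because j < k. *)
have b_cvg : (fun N => C * \sum_(j < k) (g ^- j * (g ^+ (N + j) * e (N + j)%N)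
    + g ^+ N * D)) @ \oo --> (C * \sum_(j < k) (g ^- j * 0 + 0 * D) : R).
  apply: cvgM; first exact: cvg_cst.
  apply: cvg_big => [|j _]; first exact: add_continuous.
  apply: cvgD; apply: cvgM => //; try exact: cvg_cst.
  by rewrite (cvg_shiftn j (fun N => g ^+ N * e N)).
move: b_cvg; rewrite big1 ?mulr0 => [b_cvg|j _]; last by rewrite mulr0 mul0r addr0.
apply: squeeze_cvgr (@cvg_cst _ _ _ _ _) b_cvg.
near=> N; rewrite mulr_ge0 ?exprn_ge0 ?(ltW g0) //=.
apply: le_trans (_ : g ^+ N * (C * \sum_(j < k) (e (N + j)%N + D)) <= _).
  by rewrite ler_wpM2l // exprn_ge0 // ltW.
rewrite mulrCA mulr_sumr le_eqVlt; apply/orP; left; apply/eqP; congr (_ * _).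
apply: eq_bigr => j _; rewrite exprD mulrDr; congr (_ + _).
by move: (g ^+ j) (gn0 j) => a a0; field.
Unshelve. all: by end_near. Qed.

End discounted_tail.

(** * The Riccati equation *)

Section riccati_solution.
Context {R : realType} {n m : nat}.
Variables (g : R) (A : 'M[R]_n) (B : 'M[R]_(n, m)) (Q : 'M[R]_n) (Rc : 'M[R]_m).
Hypotheses (g01 : 0 < g < 1) (hR : posdef Rc) (hQ : psd Q).

Let g0 : 0 <= g. Proof. by case/andP: g01 => /ltW. Qed.

Local Notation F := (riccati_map g A B Q Rc).
Local Notation L := (gain g A B Rc).
Local Notation H := (Rhat g B Rc).

Lemma psd_riccati_map P : psd P -> psd (F P).
Proof.
move=> pP; have [sP qP] := pP; have [sQ qQ] := hQ.
have [sH _] := posdef_Rhat B g0 hR pP.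
split=> [|x]; last first.
  rewrite (riccati_quad_gain A B Q g0 hR x pP) !addr_ge0 ?qQ ?mulr_ge0 ?qP //.
  exact: (proj2 (psd_posdef hR)).
rewrite /riccati_map !linearD /= linearN /= !linearZ /= !trmx_mul !trmxK.
by rewrite trmx_inv sH sP sQ !mulmxA.
Qed.

Lemma riccati_map_mono P P' : psd P -> psd P' ->
  (forall x, quad P x <= quad P' x) -> forall x, quad (F P) x <= quad (F P') x.
Proof.
move=> pP pP' le x; rewrite (riccati_quad_gain A B Q g0 hR x pP').
apply: le_trans (riccati_quad_le A B Q g0 hR x (- (L P' *m x)) pP) _.
by rewrite mulmxN mulmxA lerD2l ler_wpM2l.
Qed.

(** The matrix of the optimal noise-free N-stage cost with terminal weight 0. *)
Definition value_iter (N : nat) : 'M[R]_n := iter N F 0.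

Lemma psd_value_iter N : psd (value_iter N).
Proof. by elim: N => [|N IH]; [exact: psd0|exact: psd_riccati_map]. Qed.

Lemma value_iterS N x : quad (value_iter N) x <= quad (value_iter N.+1) x.
Proof.
elim: N x => [|N IH] x.
  rewrite quadE /bl mulmx0 mul0mx mxE; exact: (proj2 (psd_value_iter 1)).
exact: (riccati_map_mono (psd_value_iter N) (psd_value_iter N.+1) IH).
Qed.

Lemma value_iter_nd x : nondecreasing_seq (fun N => quad (value_iter N) x).
Proof. by apply/nondecreasing_seqP => N; exact: value_iterS. Qed.

Lemma steerS u x k :
  steer A B u x k.+1 = steer A B (fun j => u j.+1) (A *m x + B *m u 0) k.
Proof. by elim: k => //= k ->. Qed.

(** Following u costs a finite amount that bounds every iterate: the Bellman inequality spends one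
    control per step, and the value at the origin is 0. *)
Lemma value_iter_bounded k u x : steer A B u x k = 0 ->
  exists C, forall N, quad (value_iter N) x <= C.
Proof.
elim: k u x => [|k IH] u x.
  by move=> /= ->; exists 0 => N; rewrite quadE bl0l.
rewrite steerS => /IH[C hC].
exists (quad Q x + quad Rc (u 0%N) + g * C) => -[|N].
  apply: le_trans (value_iterS 0 x) _; rewrite /value_iter [iter _ _ _]/=.
  apply: le_trans (riccati_quad_le A B Q g0 hR x (u 0%N) (psd0 n)) _.
  by rewrite lerD2l ler_wpM2l //; exact: hC 0%N.
apply: le_trans (riccati_quad_le A B Q g0 hR x (u 0%N) (psd_value_iter N)) _.
by rewrite lerD2l ler_wpM2l.
Qed.

Hypothesis hAB : controllable A B.

Definition riccati_sol : 'M[R]_n :=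
  \matrix_(i, j) limn (fun N => value_iter N i j).

Lemma quad_value_iter_is_cvg x : cvgn (fun N => quad (value_iter N) x).
Proof.
apply: nondecreasing_is_cvgn; first exact: value_iter_nd.
have [k [u /value_iter_bounded[C hC]]] := hAB x 0.
by exists C => _ [N _ <-].
Qed.

(** Only the quadratic forms are monotone; polarization carries their convergence over to the
    entries, for which [riccati_sol] takes limits. *)
Lemma value_iter_cvg i j :
  (fun N => value_iter N i j) @ \oo --> riccati_sol i j.
Proof.
rewrite mxE.
suff : cvgn (fun N => value_iter N i j) by [].
set a : 'cV[R]_n := delta_mx i ord0; set b : 'cV[R]_n := delta_mx j ord0.
have -> : (fun N => value_iter N i j) = (fun N => 2^-1 *
    (quad (value_iter N) (a + b) - quad (value_iter N) a - quad (value_iter N) b)).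
  apply/funext => N; have [sN _] := psd_value_iter N.
  by rewrite quadD // bl_delta; field.
apply: is_cvgM; first exact: is_cvg_cst.
by apply: is_cvgB; [apply: is_cvgB|]; exact: quad_value_iter_is_cvg.
Qed.

Lemma quad_value_iter_cvg x :
  (fun N => quad (value_iter N) x) @ \oo --> quad riccati_sol x.
Proof.
rewrite quadE blE.
under eq_cvg do rewrite quadE blE.
apply: cvg_big => [|i _]; first exact: add_continuous.
apply: cvg_big => [|j _]; first exact: add_continuous.
by apply: cvgM; [apply: cvgM; [exact: value_iter_cvg|]|]; exact: cvg_cst.
Qed.

Lemma value_iter_le N x : quad (value_iter N) x <= quad riccati_sol x.
Proof.
rewrite -(cvg_lim _ (@quad_value_iter_cvg x)) //.
apply: nondecreasing_cvgn_le; first exact: value_iter_nd.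
exact: quad_value_iter_is_cvg.
Qed.

Lemma psd_riccati_sol : psd riccati_sol.
Proof.
split=> [|x]; last first.
  by apply: le_trans (value_iter_le 0 x); exact: (proj2 (psd_value_iter 0)).
apply/matrixP => i j; rewrite !mxE.
suff -> : (fun N => value_iter N j i) = (fun N => value_iter N i j) by [].
by apply/funext => N; rewrite -[in RHS](proj1 (psd_value_iter N)) mxE.
Qed.

(* The gains of the iterates are bounded on each vector, because the stage
   cost of the minimizing control is at most the value. *)
Lemma riccati_sol_ge x : quad (F riccati_sol) x <= quad riccati_sol x.
Proof.
have pP := psd_riccati_sol; set P := riccati_sol in pP *.
pose uN N := - (L (value_iter N) *m x).
pose yN N := A *m x + B *m uN N.
(* The minimizer for the N-th iterate is tried as a control for P. Its cost with terminal weight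
   [value_iter N] is the next iterate at x, hence at most that of P, so the excess is the gap
   between P and [value_iter N] at the successor [yN N]. *)
have h N : quad (F P) x <= quad P x + g * quad (P - value_iter N) (yN N).
  apply: le_trans (riccati_quad_le A B Q g0 hR x (uN N) pP) _.
  rewrite -/(yN N) [quad (P - _) _]quadE blDM blNM -!quadE.
  have := value_iter_le N.+1 x; rewrite -/P /value_iter [iter _ _ _]/=.
  rewrite -/(value_iter N).
  rewrite (riccati_quad_gain A B Q g0 hR x (psd_value_iter N)).
  have -> : A *m x - B *m L (value_iter N) *m x = yN N.
    by rewrite /yN /uN mulmxN mulmxA.
  rewrite -/(uN N) mulrBr; lra.
have hu N : quad Rc (uN N) <= quad P x.
  apply: le_trans (value_iter_le N.+1 x); rewrite /value_iter [iter _ _ _]/=.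
  rewrite -/(value_iter N).
  rewrite (riccati_quad_gain A B Q g0 hR x (psd_value_iter N)).
  rewrite -/(uN N) -[leLHS]addr0 -[leLHS]add0r addrA lerD //.
    by rewrite lerD2r (proj2 hQ).
  by rewrite mulr_ge0 // (proj2 (psd_value_iter N)).
have [C C0 hC] := quad_le (B^T *m 1%:M *m B) hR.
pose K := 2 * quad 1%:M (A *m x) + 2 * (C * quad P x).
have hy N : quad 1%:M (yN N) <= K.
  apply: le_trans (psd_quadD_le _ _ (psd_posdef (posdef1 _))) _.
  rewrite lerD2l ler_pM2l // [leLHS]quadE bl_mulr bl_mull mulmxA -quadE.
  by apply: le_trans (hC _) _; rewrite ler_wpM2l.
(* The entries of the gap tend to 0 while the successors stay bounded by K. *)
have lim0 : (fun N => g * ((\sum_i \sum_j `|(P - value_iter N) i j|) * K)) @ \oo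
    --> g * ((\sum_(i < n) \sum_(j < n) `|0 : R|) * K).
  apply: cvgM; first exact: cvg_cst.
  apply: cvgM; last exact: cvg_cst.
  apply: cvg_big => [|i _]; first exact: add_continuous.
  apply: cvg_big => [|j _]; first exact: add_continuous.
  apply: cvg_norm.
  have -> : (fun N => (P - value_iter N) i j) = (fun N => P i j - value_iter N i j).
    by apply/funext => N; rewrite !mxE.
  rewrite -(subrr (P i j)); apply: cvgB; [exact: cvg_cst|exact: value_iter_cvg].
move: lim0; rewrite [X in g * (X * _)]big1 => [|i _]; last first.
  by rewrite big1 // => j _; rewrite normr0.
rewrite mul0r mulr0 => lim0.
have lim1 : (fun N => quad P x + g * ((\sum_i \sum_j `|(P - value_iter N) i j|) * K))
    @ \oo --> quad P x + 0 by apply: cvgD lim0; exact: cvg_cst.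
rewrite addr0 in lim1.
apply: cvgr_to_ge lim1 _.
apply: nearW => N; apply: le_trans (h N) _; rewrite lerD2l ler_wpM2l //.
apply: le_trans (quad_le_coord _ _) _; apply: ler_wpM2l.
  by rewrite sumr_ge0 // => i _; rewrite sumr_ge0.
by rewrite -quad1E.
Qed.

(** Each iterate is at most the next one, which by monotonicity of the map is at most the image of
    the limit. *)
Lemma riccati_sol_le x : quad riccati_sol x <= quad (F riccati_sol) x.
Proof.
rewrite -(cvg_lim _ (@quad_value_iter_cvg x)) //.
apply: limr_le; first exact: quad_value_iter_is_cvg.
apply: nearW => N; apply: le_trans (value_iterS N x) _.
apply: riccati_map_mono; [exact: psd_value_iter|exact: psd_riccati_sol|].
exact: value_iter_le.
Qed.

Lemma riccati_solP : riccati g A B Q Rc riccati_sol.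
Proof.
have pP := psd_riccati_sol.
apply: quad_inj => [||z]; first by case: pP.
  by case: (psd_riccati_map pP).
by apply/eqP; rewrite eq_le riccati_sol_le riccati_sol_ge.
Qed.

End riccati_solution.

(** * Uniqueness of the Riccati solution *)

Section riccati_uniqueness.
Context {R : realType} {n m : nat}.
Variables (g : R) (A : 'M[R]_n) (B : 'M[R]_(n, m)) (Q Qh : 'M[R]_n) (Rc : 'M[R]_m).
Hypotheses (g01 : 0 < g < 1) (hR : posdef Rc) (hQ : psd Q).
Hypotheses (hQh : psd_sqrt_of Qh Q) (hAQ : observable A Qh).

Let g0 : 0 <= g. Proof. by case/andP: g01 => /ltW. Qed.

(** Along the loop closed with the gain of P, the form of P at z equals cost plus boundary term
    exactly, while that of P' is only bounded by cost plus its own boundary term. Observability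
    makes the latter vanish; exchanging P and P' then gives equality. *)
Lemma riccati_quad_le_sol P P' : psd P -> riccati g A B Q Rc P ->
  psd P' -> riccati g A B Q Rc P' -> forall z, quad P' z <= quad P z.
Proof.
move=> pP rP pP' rP' z.
pose L := gain g A B Rc P.
pose x N := iter N (fun y => A *m y + B *m (- (L *m y))) z.
pose u N := - (L *m x N).
have dyn N : x N.+1 = A *m x N + B *m u N by [].
pose c N := quad Q (x N) + quad Rc (u N).
have c0 N : 0 <= c N.
  by rewrite addr_ge0 ?(proj2 hQ) // (proj2 (psd_posdef hR)).
have sumP N : \sum_(j < N) g ^+ j * c j + g ^+ N * quad P (x N) = quad P z.
  elim: N => [|N <-]; first by rewrite big_ord0 expr0 mul1r add0r.
  have := riccati_quad A B Q g0 hR (x N) (u N) pP.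
  rewrite (esym rP : riccati_map g A B Q Rc P = P) -dyn /u addNr.
  rewrite [quad _ 0]quadE bl0l addr0 -/(u N) -/(c N) => <-.
  rewrite big_ord_recr /= exprS; ring.
have sumP' N : quad P' z <= \sum_(j < N) g ^+ j * c j + g ^+ N * quad P' (x N).
  elim: N => [|N IH]; first by rewrite big_ord0 expr0 mul1r add0r.
  apply: le_trans IH _.
  have := riccati_quad_le A B Q g0 hR (x N) (u N) pP'.
  rewrite (esym rP' : riccati_map g A B Q Rc P' = P') -dyn -/(c N) => h.
  rewrite big_ord_recr /= exprSr -addrA lerD2l -mulrA -mulrDr.
  by rewrite ler_wpM2l // exprn_ge0.
have sum_le N : \sum_(j < N) g ^+ j * c j <= quad P z.
  by rewrite -(sumP N) lerDl mulr_ge0 ?exprn_ge0 // (proj2 pP).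
have [k [C C0 hC]] := obs_bound B hR hQ hQh hAQ P'.
have tail : (fun N => g ^+ N * quad P' (x N)) @ \oo --> (0 : R).
  (* The path is noise-free, so D = 0 and the stage energy is the stage cost. *)
  apply: (@discounted_tail_cvg0 _ g _ c C 0 k) => //.
  - by move=> N; exact: (proj2 pP').
  - by exists (quad P z).
  - move=> N.
    have dyn0 j : x j.+1 = A *m x j + B *m u j + 0 by rewrite dyn addr0.
    apply: le_trans (hC x u (fun=> 0) dyn0 N) _.
    rewrite le_eqVlt; apply/orP; left; apply/eqP; congr (_ * _).
    apply: eq_bigr => j _; rewrite /stage_energy.
    by rewrite [quad 1%:M 0]quadE bl0l.
have lim1 : (fun N => quad P z + g ^+ N * quad P' (x N)) @ \oo --> quad P z + 0.
  by apply: cvgD tail; exact: cvg_cst.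
rewrite addr0 in lim1.
apply: cvgr_to_ge lim1 _.
by apply: nearW => N; apply: le_trans (sumP' N) _; rewrite lerD2r.
Qed.

Lemma riccati_unique P P' : psd P -> riccati g A B Q Rc P ->
  psd P' -> riccati g A B Q Rc P' -> P' = P.
Proof.
move=> pP rP pP' rP'; apply: quad_inj; [by case: pP'|by case: pP|].
by move=> z; apply/eqP; rewrite eq_le !riccati_quad_le_sol.
Qed.

End riccati_uniqueness.

(** * Measurability of the closed loop *)

Section measurable_data.
Context {d : measure_display} {T : measurableType d}.

Lemma measurable_fun_matrix {d'} {V : measurableType d'} m n
    (f : T -> 'M[V]_(m, n)) :
  (forall i j, measurable_fun setT (fun t => f t i j)) -> measurable_fun setT f.
Proof.
move=> mf; apply: (measurability _ (erefl : measurable = <<s @matrix_entries _ V m n >>)).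
move=> _ [_ [[i j] _ [E mE <-]] <-]; rewrite !setTI.
by have := mf i j measurableT _ mE; rewrite setTI.
Qed.

Lemma measurable_entry {d'} {V : measurableType d'} m n i j :
  measurable_fun setT (fun M : 'M[V]_(m, n) => M i j).
Proof.
move=> _ E mE; apply: sub_sigma_algebra; exists (i, j) => //.
by exists E.
Qed.

Lemma measurable_fun_seq {d'} {V : measurableType d'} (f : T -> nat -> V) :
  (forall s, measurable_fun setT (fun t => f t s)) -> measurable_fun setT f.
Proof.
move=> mf; apply: (measurability _ (erefl : measurable = <<s @seq_entries _ V >>)).
move=> _ [_ [s _ [E mE <-]] <-]; rewrite !setTI.
by have := mf s measurableT _ mE; rewrite setTI.
Qed.

Lemma measurable_seq_entry {d'} {V : measurableType d'} s :
  measurable_fun setT (fun f : nat -> V => f s).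
Proof.
by move=> _ E mE; apply: sub_sigma_algebra; exists s => //; exists E.
Qed.

Lemma measurable_Some {d'} {V : measurableType d'} :
  measurable_fun setT (@Some V).
Proof. by move=> _ E mE; rewrite setTI. Qed.

Lemma measurable_omap {d1} {V1 : measurableType d1} {d2} {V2 : measurableType d2}
    (g : V1 -> V2) : measurable_fun setT g -> measurable_fun setT (omap g).
Proof.
move=> mg _ E mE; rewrite setTI.
by have := mg measurableT _ mE; rewrite setTI.
Qed.

Lemma measurable_odflt {d1} {V : measurableType d1} (v : V) :
  measurable_fun setT (odflt v).
Proof. by move=> _ E mE; rewrite setTI. Qed.

End measurable_data.

Section measurable_linear.
Context {d : measure_display} {T : measurableType d} {R : realType}.

Lemma measurable_sum_ord n (f : 'I_n -> T -> R) :
  (forall i, measurable_fun setT (f i)) ->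
  measurable_fun setT (fun t => \sum_i f i t).
Proof. by move=> mf; exact: measurable_sum. Qed.

Lemma measurable_mulmx_l m n p (M : 'M[R]_(m, n)) (f : T -> 'M[R]_(n, p)) :
  measurable_fun setT f -> measurable_fun setT (fun t => M *m f t).
Proof.
move=> mf; apply: measurable_fun_matrix => i j.
under eq_fun do rewrite mxE.
apply: measurable_sum_ord => k; apply: measurable_funM => //.
exact: (measurableT_comp (measurable_entry _ _) mf).
Qed.

Lemma measurable_addmx m n (f h : T -> 'M[R]_(m, n)) :
  measurable_fun setT f -> measurable_fun setT h ->
  measurable_fun setT (fun t => f t + h t).
Proof.
move=> mf mh; apply: measurable_fun_matrix => i j.
under eq_fun do rewrite mxE.
by apply: measurable_funD; apply: (measurableT_comp (measurable_entry _ _)).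
Qed.

Lemma measurable_bl m n (M : 'M[R]_(m, n)) (y : T -> 'cV[R]_m) (z : T -> 'cV[R]_n) :
  measurable_fun setT y -> measurable_fun setT z ->
  measurable_fun setT (fun t => bl M (y t) (z t)).
Proof.
move=> my mz; under eq_fun do rewrite blE.
apply: measurable_sum_ord => i; apply: measurable_sum_ord => j.
apply: measurable_funM; first apply: measurable_funM => //.
  exact: (measurableT_comp (measurable_entry _ _) my).
exact: (measurableT_comp (measurable_entry _ _) mz).
Qed.

End measurable_linear.

Section measurable_loop.
Context {R : realType} {nx nu : nat}.
Variables (A : 'M[R]_nx) (B : 'M[R]_(nx, nu)).
Variables (mc : cpolicy R nx nu) (ms : spolicy R nx nu).
Hypotheses (hmc : policies_C mc) (hms : policies_S ms).
Context {d : measure_display} {T : measurableType d}.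
Variables (x0 : T -> 'cV[R]_nx) (W : nat -> T -> 'cV[R]_nx).

Local Notation X k := (fun t => state A B mc ms (x0 t) (W ^~ t) k).
Local Notation U k := (fun t => control A B mc ms (x0 t) (W ^~ t) k).
Local Notation S k := (fun t => schedule A B mc ms (x0 t) (W ^~ t) k).
Local Notation I k := (fun t => cinfo_at A B mc ms (x0 t) (W ^~ t) k).

Lemma measurable_info_S (x : nat -> T -> 'cV[R]_nx) (u : nat -> T -> 'cV[R]_nu)
    (a : nat -> T -> bool) k :
  (forall s, (s <= k)%N -> measurable_fun setT (x s)) ->
  (forall s, (s < k)%N -> measurable_fun setT (u s)) ->
  (forall s, (s < k)%N -> measurable_fun setT (a s)) ->
  measurable_fun setT (fun t => info_S (x ^~ t) (u ^~ t) (a ^~ t) k).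
Proof.
move=> mx mu ma.
apply: measurable_fun_pair; first apply: measurable_fun_pair.
- apply: measurable_fun_seq => s /=.
  have [/andP[_ sk]|_] := boolP ((0 < k)%N && (s <= k)%N); last exact: measurable_cst.
  exact: (measurableT_comp measurable_Some (mx _ sk)).
- apply: measurable_fun_seq => s /=.
  have [sk|_] := boolP (s < k)%N; last exact: measurable_cst.
  exact: (measurableT_comp measurable_Some (mu _ sk)).
- apply: measurable_fun_seq => s /=.
  by have [sk|_] := ltnP s k; [exact: ma|exact: measurable_cst].
Qed.

Lemma measurable_info_C (x : nat -> T -> 'cV[R]_nx) (u : nat -> T -> 'cV[R]_nu)
    (a : nat -> T -> bool) k :
  (forall s, (s <= k)%N -> measurable_fun setT (x s)) ->
  (forall s, (s < k)%N -> measurable_fun setT (u s)) ->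
  (forall s, (s <= k)%N -> measurable_fun setT (a s)) ->
  measurable_fun setT (fun t => info_C (x ^~ t) (u ^~ t) (a ^~ t) k).
Proof.
move=> mx mu ma; apply: measurable_fun_pair.
- apply: measurable_fun_seq => s /=.
  have [_|_] /= := boolP (0 < k)%N; last exact: measurable_cst.
  have [sk|_] /= := leqP s k; last exact: measurable_cst.
  apply: measurable_fun_ifT; [exact: ma| |exact: measurable_cst].
  exact: (measurableT_comp measurable_Some (mx _ sk)).
- apply: measurable_fun_seq => s /=.
  have [sk|_] := boolP (s < k)%N; last exact: measurable_cst.
  exact: (measurableT_comp measurable_Some (mu _ sk)).
Qed.

(** The sigma-algebra on the sample space is arbitrary and only the noises before k are assumed
    measurable. Applied to the sigma-algebra generated by x_0 and these noises, the lemma shows that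
    the information at time k depends on the past alone. *)
Lemma measurable_loop k : measurable_fun setT x0 ->
  (forall j, (j < k)%N -> measurable_fun setT (W j)) ->
  [/\ forall s, (s <= k)%N -> measurable_fun setT (X s),
      forall s, (s <= k)%N -> measurable_fun setT (U s),
      forall s, (s <= k)%N -> measurable_fun setT (S s)
    & forall s, (s <= k)%N -> measurable_fun setT (I s)].
Proof.
move=> mx0 mW.
suff : forall s, (s <= k)%N -> [/\ measurable_fun setT (X s),
    measurable_fun setT (U s), measurable_fun setT (S s)
    & measurable_fun setT (I s)].
  by move=> h; split=> s /h[].
elim/ltn_ind => s IH sk.
have IH' r : (r < s)%N -> [/\ measurable_fun setT (X r),
    measurable_fun setT (U r), measurable_fun setT (S r)
    & measurable_fun setT (I r)].
  by move=> rs; apply: IH => //; exact: leq_trans (ltnW rs) sk.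
have mX : measurable_fun setT (X s).
  case: s IH sk IH' => [|s] _ sk IH'; first exact: mx0.
  have [mX mU _ _] := IH' s (ltnSn _).
  under eq_fun do rewrite stateS.
  apply: measurable_addmx; last exact: mW.
  by apply: measurable_addmx; exact: measurable_mulmx_l.
have mXs r : (r <= s)%N -> measurable_fun setT (X r).
  by rewrite leq_eqVlt => /predU1P[->//|/IH'[]].
have mS : measurable_fun setT (S s).
  under eq_fun do rewrite scheduleE.
  apply: (measurableT_comp (hms s)).
  by apply: (measurable_info_S (x := fun s => X s) (u := fun s => U s)
    (a := fun s => S s)) => // r /IH'[].
have mI : measurable_fun setT (I s).
  apply: (measurable_info_C (x := fun s => X s) (u := fun s => U s)
    (a := fun s => S s)) => // r; first by move=> /IH'[].
  by rewrite leq_eqVlt => /predU1P[->//|/IH'[]].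
split=> //; under eq_fun do rewrite controlE.
exact: (measurableT_comp (hmc s)).
Qed.

End measurable_loop.

(** * Perturbed policies *)

Section deviation.
Context {R : realType} {nx nu : nat}.
Variables (A : 'M[R]_nx) (B : 'M[R]_(nx, nu)) (L : 'M[R]_(nu, nx)).
Variables (k : nat) (v : 'cV[R]_nu).

(** Response of the noise-free loop with feedback - L to an impulse v in the control at time k; the
    control deviation is inlined because it depends on the state deviation. *)
Fixpoint dev_x (j : nat) : 'cV[R]_nx :=
  if j is i.+1
  then A *m dev_x i + B *m ((if i == k then v else 0) - L *m dev_x i) else 0.

Definition dev_u (j : nat) : 'cV[R]_nu :=
  (if j == k then v else 0) - L *m dev_x j.

Lemma dev_xS j : dev_x j.+1 = A *m dev_x j + B *m dev_u j.
Proof. by []. Qed.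

Lemma dev_x_eq0 j : (j <= k)%N -> dev_x j = 0.
Proof.
elim: j => // j IH ltjk /=.
by rewrite IH ?(ltnW ltjk) // ltn_eqF // !mulmx0 subr0 mulmx0 addr0.
Qed.

Lemma dev_u_eq0 j : (j < k)%N -> dev_u j = 0.
Proof.
by move=> ltjk; rewrite /dev_u dev_x_eq0 ?(ltnW ltjk) // ltn_eqF // mulmx0 subr0.
Qed.

Lemma dev_u_gain j : dev_u j + L *m dev_x j = if j == k then v else 0.
Proof. by rewrite /dev_u subrK. Qed.

Definition unshift_C (i : cinfo R nx nu) : cinfo R nx nu :=
  (fun s => omap (fun x => x + - dev_x s) (i.1 s),
   fun r => omap (fun u => u + - dev_u r) (i.2 r)).

Definition unshift_S (i : sinfo R nx nu) : sinfo R nx nu :=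
  (unshift_C i.1, i.2).

(** Recovers I_C(k) from I_C(j) for j >= k. The test 0 < k matters for k = 0: x_0 may be visible at
    time j although I_C(0) is empty. *)
Definition past_C (i : cinfo R nx nu) : cinfo R nx nu :=
  (fun s => if (0 < k)%N && (s <= k)%N then i.1 s else None,
   fun r => if (r < k)%N then i.2 r else None).

(** Recovers I_C(k) from the scheduler's data by keeping only the transmitted states. This needs j >
    k, because a_k enters the recorded transmission times one step later. *)
Definition past_S (i : sinfo R nx nu) : cinfo R nx nu :=
  (fun s => if (0 < k)%N && (s <= k)%N then
     if i.2 s then i.1.1 s else None else None,
   fun r => if (r < k)%N then i.1.2 r else None).

Variables (E : set (cinfo R nx nu)).
Variables (mc : cpolicy R nx nu) (ms : spolicy R nx nu).

(* On the event that the information of the controller at time k lies in E, the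
   control is moved by v at time k and by -L times the resulting state
   deviation afterwards.  The policies first restore the data of the original
   loop, so that the transmission times do not change. *)
Definition perturbed_C : cpolicy R nx nu := fun j i =>
  if past_C i \in E then mc j (unshift_C i) + dev_u j else mc j i.

Definition perturbed_S : spolicy R nx nu := fun j i =>
  if past_S i \in E then ms j (unshift_S i) else ms j i.

Section same_schedule.
Variables (x x' : nat -> 'cV[R]_nx) (u u' : nat -> 'cV[R]_nu).
Variables (a a' : nat -> bool) (j : nat).
Let b := info_C x u a k \in E.
Hypothesis hx : forall s, (s <= j)%N -> x' s = x s + (if b then dev_x s else 0).
Hypothesis hu : forall s, (s < j)%N -> u' s = u s + (if b then dev_u s else 0).
Hypothesis ha : forall s, (s < j)%N -> a' s = a s.

Lemma unshift_info_S : unshift_S (info_S x' u' a' j)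
  = if b then info_S x u a j else unshift_S (info_S x u a j).
Proof.
have e3 : (fun s => (s < j)%N && a' s) = (fun s => (s < j)%N && a s).
  by apply/funext => s; case: ltnP => //= /ha ->.
case: (boolP b) => bE; congr ((_, _), _) => //; apply/funext => s /=.
- by case: ifP => //= /andP[_ /hx ->]; rewrite bE addrK.
- by case: ifP => //= /hu ->; rewrite bE addrK.
- by case: ifP => //= /andP[_ /hx ->]; rewrite (negbTE bE) addr0.
- by case: ifP => //= /hu ->; rewrite (negbTE bE) addr0.
Qed.

Lemma info_S_same : (~~ b) || (j <= k)%N -> info_S x' u' a' j = info_S x u a j.
Proof.
move=> h; congr (_, _, _); apply/funext => s.
- case: ifP => //= /andP[_ sj]; rewrite hx //.
  move: h; case: b => /= [jk|_]; last by rewrite addr0.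
  by rewrite dev_x_eq0 ?addr0 // (leq_trans sj).
- case: ifP => //= sj; rewrite hu //.
  move: h; case: b => /= [jk|_]; last by rewrite addr0.
  by rewrite dev_u_eq0 ?addr0 // (leq_trans sj).
- by case: ltnP => //= /ha ->.
Qed.

Lemma unshift_S_id y (z : nat -> 'cV[R]_nu) c :
  (j <= k)%N -> unshift_S (info_S y z c j) = info_S y z c j.
Proof.
move=> jk; congr ((_, _), _); apply/funext => s /=.
- case: ifP => //= /andP[_ sj].
  by rewrite dev_x_eq0 ?subr0 // (leq_trans sj).
- by case: ifP => //= sj; rewrite dev_u_eq0 ?subr0 // (leq_trans sj).
Qed.

Lemma past_info_S : (k < j)%N -> past_S (info_S x' u' a' j) = info_C x u a k.
Proof.
move=> kj; congr (_, _); apply/funext => s /=.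
- case: (boolP (0 < k)%N) => //= k0; case: (leqP s k) => //= sk.
  have sj := leq_ltn_trans sk kj.
  rewrite sj /= ha // (leq_ltn_trans _ kj) //= (ltnW sj) hx ?(ltnW sj) //.
  by rewrite dev_x_eq0 // if_same addr0.
- case: ltnP => // sk; rewrite (ltn_trans sk kj) hu ?(ltn_trans sk kj) //.
  by rewrite dev_u_eq0 // if_same addr0.
Qed.

(** For j <= k the test may be wrong, as a_k is not recorded yet, but the data carry no deviation
    and both branches agree. For j > k the test returns [b]. *)
Lemma perturbed_S_info : perturbed_S j (info_S x' u' a' j) = ms j (info_S x u a j).
Proof.
rewrite /perturbed_S; case: (leqP j k) => [jk|kj].
  rewrite info_S_same ?jk ?orbT // unshift_S_id //.
  by case: ifP.
rewrite past_info_S // -/b unshift_info_S.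
by case: ifP => bE; [rewrite bE|rewrite info_S_same // bE].
Qed.

Hypothesis haj : a' j = a j.

Let ha' s : (s <= j)%N -> a' s = a s.
Proof. by rewrite leq_eqVlt => /predU1P[->//|/ha]. Qed.

Lemma unshift_info_C : b ->
  unshift_C (info_C x' u' a' j) = info_C x u a j.
Proof.
move=> bE; congr (_, _); apply/funext => s /=.
- case: (boolP (0 < j)%N) => //= j0; case: (leqP s j) => //= sj.
  by rewrite ha' //; case: ifP => //= _; rewrite hx // bE addrK.
- by case: ifP => //= /hu ->; rewrite bE addrK.
Qed.

Lemma info_C_same : (~~ b) || (j <= k)%N -> info_C x' u' a' j = info_C x u a j.
Proof.
move=> h; congr (_, _); apply/funext => s.
- case: (boolP (0 < j)%N) => //= j0; case: (leqP s j) => //= sj.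
  rewrite ha' // hx //; congr (if _ then Some _ else _).
  move: h; case: b => /= [jk|_]; last by rewrite addr0.
  by rewrite dev_x_eq0 ?addr0 // (leq_trans sj).
- case: ifP => //= sj; rewrite hu //.
  move: h; case: b => /= [jk|_]; last by rewrite addr0.
  by rewrite dev_u_eq0 ?addr0 // (leq_trans sj).
Qed.

Lemma unshift_C_id y (z : nat -> 'cV[R]_nu) c :
  (j <= k)%N -> unshift_C (info_C y z c j) = info_C y z c j.
Proof.
move=> jk; congr (_, _); apply/funext => s /=.
- case: (boolP (0 < j)%N) => //= j0; case: (leqP s j) => //= sj.
  by case: ifP => //= _; rewrite dev_x_eq0 ?subr0 // (leq_trans sj).
- by case: ifP => //= sj; rewrite dev_u_eq0 ?subr0 // (leq_trans sj).
Qed.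

Lemma past_info_C : (k <= j)%N -> past_C (info_C x' u' a' j) = info_C x u a k.
Proof.
move=> kj; congr (_, _); apply/funext => s /=.
- case: (boolP (0 < k)%N) => //= k0; case: (leqP s k) => //= sk.
  have sj := leq_trans sk kj.
  rewrite sj /= ha' // (leq_trans k0 kj) /= hx //.
  by rewrite dev_x_eq0 // if_same addr0.
- case: ltnP => // sk; have sj := leq_trans sk kj.
  by rewrite sj hu // dev_u_eq0 // if_same addr0.
Qed.

(** The controller already knows a_k at time k, so its test is exact from j = k on, in time to apply
    the impulse v. *)
Lemma perturbed_C_info : perturbed_C j (info_C x' u' a' j)
  = mc j (info_C x u a j) + (if b then dev_u j else 0).
Proof.
rewrite /perturbed_C; case: (ltnP j k) => [jk|kj].
  rewrite info_C_same ?(ltnW jk) ?orbT // unshift_C_id ?(ltnW jk) //.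
  by rewrite dev_u_eq0 // addr0 !if_same addr0.
rewrite past_info_C // -/b; case: ifP => // bE; first by rewrite unshift_info_C.
by rewrite info_C_same ?bE // addr0.
Qed.

End same_schedule.

(** Strong induction in the order state, schedule, control: the control at time j reads a_j, whose
    agreement in both loops must come first. *)
Lemma perturbed_loop x0 w j :
  let b := cinfo_at A B mc ms x0 w k \in E in
  [/\ state A B perturbed_C perturbed_S x0 w j
      = state A B mc ms x0 w j + (if b then dev_x j else 0),
      control A B perturbed_C perturbed_S x0 w j
      = control A B mc ms x0 w j + (if b then dev_u j else 0)
    & schedule A B perturbed_C perturbed_S x0 w j
      = schedule A B mc ms x0 w j].
Proof.
move=> b; elim/ltn_ind: j => j IH.
have hu s : (s < j)%N -> control A B perturbed_C perturbed_S x0 w s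
      = control A B mc ms x0 w s + (if b then dev_u s else 0) by move=> /IH[].
have ha s : (s < j)%N -> schedule A B perturbed_C perturbed_S x0 w s
      = schedule A B mc ms x0 w s by move=> /IH[].
have hxj : state A B perturbed_C perturbed_S x0 w j
      = state A B mc ms x0 w j + (if b then dev_x j else 0).
  case: j IH hu ha => [|j] IH _ _; first by rewrite !state0 if_same addr0.
  have [hx hu _] := IH j (ltnSn _); rewrite !stateS hx hu.
  case: ifP => _; last by rewrite !addr0.
  rewrite dev_xS; move: (dev_x j) (dev_u j) => y z.
  by rewrite !mulmxDr [X in X + _ = _]addrACA [LHS]addrAC.
have hx s : (s <= j)%N -> state A B perturbed_C perturbed_S x0 w s
      = state A B mc ms x0 w s + (if b then dev_x s else 0).
  by rewrite leq_eqVlt => /predU1P[->//|/IH[]].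
have haj : schedule A B perturbed_C perturbed_S x0 w j
      = schedule A B mc ms x0 w j.
  by rewrite !scheduleE; exact: perturbed_S_info.
split=> //; rewrite !controlE; exact: perturbed_C_info.
Qed.

Hypotheses (hE : measurable E) (hmc : policies_C mc) (hms : policies_S ms).

Lemma measurable_unshift_C : measurable_fun setT unshift_C.
Proof.
have mD p (c : 'cV[R]_p) : measurable_fun setT (omap (fun x => x + - c)).
  apply: measurable_omap; apply: measurable_addmx => //; exact: measurable_id.
apply: measurable_fun_pair; apply: measurable_fun_seq => s /=;
  apply: (measurableT_comp (mD _ _));
  apply: (measurableT_comp (measurable_seq_entry s)).
  exact: measurable_fst.
exact: measurable_snd.
Qed.

Lemma measurable_past_C : measurable_fun setT past_C.
Proof.
apply: measurable_fun_pair; apply: measurable_fun_seq => s /=.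
  have [_|_] := boolP ((0 < k)%N && (s <= k)%N); last exact: measurable_cst.
  exact: (measurableT_comp (measurable_seq_entry s) measurable_fst).
have [_|_] := boolP (s < k)%N; last exact: measurable_cst.
exact: (measurableT_comp (measurable_seq_entry s) measurable_snd).
Qed.

Lemma measurable_past_S : measurable_fun setT past_S.
Proof.
have mf : measurable_fun setT (fun i : sinfo R nx nu => i.1.1).
  exact: (measurableT_comp measurable_fst measurable_fst).
have ms' : measurable_fun setT (fun i : sinfo R nx nu => i.1.2).
  exact: (measurableT_comp measurable_snd measurable_fst).
apply: measurable_fun_pair; apply: measurable_fun_seq => s /=.
  have [_|_] := boolP ((0 < k)%N && (s <= k)%N); last exact: measurable_cst.
  apply: measurable_fun_ifT; last exact: measurable_cst.
    exact: (measurableT_comp (measurable_seq_entry s) measurable_snd).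
  exact: (measurableT_comp (measurable_seq_entry s) mf).
have [_|_] := boolP (s < k)%N; last exact: measurable_cst.
exact: (measurableT_comp (measurable_seq_entry s) ms').
Qed.

Lemma measurable_mem d' (T : measurableType d') d1 (V : measurableType d1)
    (f : T -> V) (D : set V) : measurable D -> measurable_fun setT f ->
  measurable_fun setT (fun t => f t \in D).
Proof.
move=> mD mf; apply: (measurable_fun_bool true).
rewrite (_ : _ `&` _ = setT `&` f @^-1` D); first exact: mf.
by apply/seteqP; split=> t [_ /=] => [/set_mem|/mem_set].
Qed.

Lemma perturbed_C_policy : policies_C perturbed_C.
Proof.
move=> j; apply: measurable_fun_ifT; last exact: hmc.
  by apply: measurable_mem => //; exact: measurable_past_C.
apply: measurable_addmx => //.
exact: (measurableT_comp (hmc j) measurable_unshift_C).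
Qed.

Lemma perturbed_S_policy : policies_S perturbed_S.
Proof.
move=> j; apply: measurable_fun_ifT; last exact: hms.
  by apply: measurable_mem => //; exact: measurable_past_S.
apply: (measurableT_comp (hms j)).
apply: measurable_fun_pair; last exact: measurable_snd.
exact: (measurableT_comp measurable_unshift_C measurable_fst).
Qed.

End deviation.

(** * Pathwise change of the cost under a deviation *)

Section deviation_cost.
Context {R : realType} {nx nu : nat}.
Variables (g : R) (A : 'M[R]_nx) (B : 'M[R]_(nx, nu)) (Q : 'M[R]_nx).
Variables (Rc : 'M[R]_nu) (P : 'M[R]_nx).
Hypotheses (g0 : 0 <= g) (hR : posdef Rc) (hQ : psd Q).
Hypotheses (pP : psd P) (rP : riccati g A B Q Rc P).
Variables (k : nat) (v : 'cV[R]_nu).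
Variables (x w : nat -> 'cV[R]_nx) (u : nat -> 'cV[R]_nu).
Hypothesis dyn : forall j, x j.+1 = A *m x j + B *m u j + w j.

Local Notation L := (gain g A B Rc P).
Local Notation H := (Rhat g B Rc P).
Local Notation xi := (dev_x A B L k v).
Local Notation de := (dev_u A B L k v).

Let h j : 'cV[R]_nu := if j == k then v else 0.

(** Completion of squares for the pair (x, xi) gives the cross term and for (xi, xi) the square. As
    [de] + L [xi] is the impulse, the H-terms survive at time k only; the noise term appears because
    x_{j+1} contains w_j. *)
Lemma dev_stage_cost j :
  quad Q (x j + xi j) + quad Rc (u j + de j)
  = quad Q (x j) + quad Rc (u j)
    + 2 * (bl P (x j) (xi j) - g * bl P (x j.+1) (xi j.+1)
           + g * bl P (w j) (xi j.+1) + bl H (u j + L *m x j) (h j))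
    + (quad P (xi j) - g * quad P (xi j.+1) + quad H (h j)).
Proof.
have e1 := riccati_bl A B Q g0 hR (x j) (xi j) (u j) (de j) pP.
have e2 := riccati_bl A B Q g0 hR (xi j) (xi j) (de j) (de j) pP.
rewrite (esym rP : riccati_map g A B Q Rc P = P) dev_u_gain -dev_xS in e1.
rewrite (esym rP : riccati_map g A B Q Rc P = P) !dev_u_gain -!dev_xS in e2.
have -> : bl P (x j.+1) (xi j.+1)
    = bl P (A *m x j + B *m u j) (xi j.+1) + bl P (w j) (xi j.+1).
  by rewrite dyn blDl.
rewrite (quadD _ _ (proj1 hQ)) (quadD _ _ (proj1 hR)) -/(h j) in e1 e2 *.
rewrite !quadE; lra.
Qed.

Lemma dev_cost_eq N :
  \sum_(j < N) g ^+ j * (quad Q (x j + xi j) + quad Rc (u j + de j))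
  = \sum_(j < N) g ^+ j * (quad Q (x j) + quad Rc (u j))
    - 2 * (g ^+ N * bl P (x N) (xi N)) - g ^+ N * quad P (xi N)
    + 2 * \sum_(j < N) g ^+ j.+1 * bl P (w j) (xi j.+1)
    + \sum_(j < N) g ^+ j * (2 * bl H (u j + L *m x j) (h j) + quad H (h j)).
Proof.
elim: N => [|N IH]; last first.
  rewrite !big_ord_recr IH dev_stage_cost /= exprS.
  move: (\sum_(i < N) _) (\sum_(i < N) _) (\sum_(i < N) _) => s1 s2 s3.
  ring.
by rewrite !big_ord0 /= bl0r quadE bl0r; ring.
Qed.

Lemma dev_cost_le N : (k < N)%N ->
  \sum_(j < N) g ^+ j * (quad Q (x j + xi j) + quad Rc (u j + de j))
  <= \sum_(j < N) g ^+ j * (quad Q (x j) + quad Rc (u j))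
    + g ^+ N * quad P (x N)
    + 2 * \sum_(j < N) g ^+ j.+1 * bl P (w j) (xi j.+1)
    + g ^+ k * (2 * bl H (u k + L *m x k) v + quad H v).
Proof.
move=> kN; rewrite dev_cost_eq.
have -> : \sum_(j < N) g ^+ j * (2 * bl H (u j + L *m x j) (h j) + quad H (h j))
    = g ^+ k * (2 * bl H (u k + L *m x k) (h k) + quad H (h k)).
  rewrite (bigD1 (Ordinal kN)) //= big1 => [|j jk]; first by rewrite addr0.
  have -> : h j = 0.
    by rewrite /h ifN //; apply: contra_neqN jk => /eqP jk; exact: val_inj.
  by rewrite bl0r quadE bl0r; ring.
have -> : h k = v by rewrite /h eqxx.
rewrite lerD2r lerD2r -!addrA lerD2l.
(* The boundary terms add up to |x_N|_P^2 - |x_N + xi_N|_P^2, so the deviation drops out of the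
   bound. *)
have := proj2 pP (x N + xi N); rewrite quadD ?(proj1 pP) // => q0.
have := mulr_ge0 (exprn_ge0 N g0) q0; lra.
Qed.

End deviation_cost.

(** * Square-integrable random vectors *)

Section square_integrable.
Context {d : measure_display} {T : measurableType d} {R : realType}.
Variable Pr : probability T R.
Implicit Types f h : T -> R.

Definition integrable1 f := Pr.-integrable setT (EFin \o f).

Definition sq_integrable f :=
  measurable_fun setT f /\ integrable1 (fun t => f t ^+ 2).

Lemma integrable1_measurable f : integrable1 f -> measurable_fun setT f.
Proof. by move=> /integrableP[/measurable_EFinP]. Qed.

Lemma integrable1_le f h : measurable_fun setT f -> integrable1 h ->
  (forall t, `|f t| <= h t) -> integrable1 f.
Proof.
move=> mf ih fh; apply: le_integrable ih => //; first exact/measurable_EFinP.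
by move=> t _ /=; rewrite lee_fin (le_trans (fh t)) // ler_norm.
Qed.

Lemma integrable1D f h : integrable1 f -> integrable1 h ->
  integrable1 (fun t => f t + h t).
Proof. by move=> i1 i2; exact: (integrableD _ i1 i2). Qed.

Lemma integrable1Z c f : integrable1 f -> integrable1 (fun t => c * f t).
Proof. by move=> i1; exact: (integrableZl _ c i1). Qed.

Lemma integrable1_cst c : integrable1 (fun=> c).
Proof. exact: finite_measure_integrable_cst. Qed.

Lemma integrable1_sum (I : Type) (s : seq I) (F : I -> T -> R) :
  (forall i, integrable1 (F i)) -> integrable1 (fun t => \sum_(i <- s) F i t).
Proof.
move=> iF; elim: s => [|i s IH].
  by under eq_fun do rewrite big_nil; exact: integrable1_cst.
by under eq_fun do rewrite big_cons; exact: integrable1D.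
Qed.

Lemma integrable1_indic f (S : set T) : measurable S -> integrable1 f ->
  integrable1 (fun t => (t \in S)%:R * f t).
Proof.
move=> mS iF; apply: (@integrable1_le _ (fun t => `|f t|)).
- apply: measurable_funM; last exact: integrable1_measurable.
  exact: (measurable_indic mS).
- exact: integrable_norm.
- by move=> t; case: (_ \in _); rewrite ?mul1r // mul0r normr0.
Qed.

Lemma Rintegral_indicE f (S : set T) :
  \int[Pr]_t ((t \in S)%:R * f t) = \int[Pr]_(t in S) f t.
Proof.
rewrite [RHS]Rintegral_mkcond; apply: eq_Rintegral => t _.
by rewrite patchE; case: ifPn => _; rewrite ?mul1r ?mul0r.
Qed.

Lemma RintegralT_D f h : integrable1 f -> integrable1 h ->
  \int[Pr]_t (f t + h t) = \int[Pr]_t f t + \int[Pr]_t h t.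
Proof. by move=> i1 i2; exact: RintegralD. Qed.

Lemma RintegralT_Z c f : integrable1 f ->
  \int[Pr]_t (c * f t) = c * \int[Pr]_t f t.
Proof. by move=> i1; exact: RintegralZl. Qed.

Lemma RintegralT_cst c : \int[Pr]_t c = c.
Proof.
rewrite Rintegral_cst // -[RHS]mulr1; congr (_ * _).
exact: (congr1 fine (probability_setT Pr)).
Qed.

Lemma RintegralT_sum (I : Type) (s : seq I) (F : I -> T -> R) :
  (forall i, integrable1 (F i)) ->
  \int[Pr]_t (\sum_(i <- s) F i t) = \sum_(i <- s) \int[Pr]_t F i t.
Proof.
move=> iF; elim: s => [|i s IH].
  rewrite big_nil; under eq_Rintegral do rewrite big_nil.
  by rewrite Rintegral_cst // mul0r.
rewrite big_cons -IH -RintegralT_D //; last exact: integrable1_sum.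
by under eq_Rintegral do rewrite big_cons.
Qed.

Lemma Rintegral_sum_in (S : set T) (I : Type) (s : seq I) (F : I -> T -> R) :
  measurable S -> (forall i, integrable1 (F i)) ->
  \int[Pr]_(t in S) (\sum_(i <- s) F i t) = \sum_(i <- s) \int[Pr]_(t in S) F i t.
Proof.
move=> mS iF; rewrite -Rintegral_indicE.
under eq_Rintegral do rewrite mulr_sumr.
rewrite RintegralT_sum => [|i]; last exact: integrable1_indic.
by apply: eq_bigr => i _; rewrite Rintegral_indicE.
Qed.

Lemma EFin_Rintegral (S : set T) f : measurable S -> integrable1 f ->
  ((\int[Pr]_(t in S) f t)%:E = \int[Pr]_(t in S) (f t)%:E)%E.
Proof.
move=> mS iF; rewrite fineK //; apply: integrable_fin_num => //.
exact: integrableS iF.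
Qed.

Lemma le_RintegralT f h : integrable1 f -> integrable1 h ->
  (forall t, f t <= h t) -> \int[Pr]_t f t <= \int[Pr]_t h t.
Proof. by move=> i1 i2 fh; exact: le_Rintegral. Qed.

Lemma sq_integrable_mul f h : sq_integrable f -> sq_integrable h ->
  integrable1 (fun t => f t * h t).
Proof.
move=> [mf i1] [mh i2]; apply: integrable1_le (integrable1D i1 i2) _.
  exact: measurable_funM.
move=> t; rewrite normrM -(real_normK (num_real (f t))).
rewrite -(real_normK (num_real (h t))).
have := sqr_ge0 (`|f t| - `|h t|); have := normr_ge0 (f t).
have := normr_ge0 (h t); move: `|f t| `|h t| => a b; nra.
Qed.

Lemma sq_integrable_cst c : sq_integrable (fun=> c).
Proof. by split; [exact: measurable_cst|exact: integrable1_cst]. Qed.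

Lemma sq_integrable_integrable f : sq_integrable f -> integrable1 f.
Proof.
move=> lf; have := sq_integrable_mul (sq_integrable_cst 1) lf.
by under eq_fun do rewrite mul1r.
Qed.

Lemma sq_integrableD f h : sq_integrable f -> sq_integrable h ->
  sq_integrable (fun t => f t + h t).
Proof.
move=> lf lh; split; first by apply: measurable_funD; [case: lf|case: lh].
under eq_fun do rewrite sqrrD.
apply: integrable1D; last by case: lh.
apply: integrable1D; first by case: lf.
under eq_fun do rewrite -mulr_natl.
by apply: integrable1Z; exact: sq_integrable_mul.
Qed.

Lemma sq_integrableZ c f : sq_integrable f -> sq_integrable (fun t => c * f t).
Proof.
move=> [mf i1]; split; first exact: measurable_funM.
by under eq_fun do rewrite exprMn; exact: integrable1Z.
Qed.

Lemma sq_integrable_sum (I : Type) (s : seq I) (F : I -> T -> R) :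
  (forall i, sq_integrable (F i)) -> sq_integrable (fun t => \sum_(i <- s) F i t).
Proof.
move=> iF; elim: s => [|i s IH].
  by under eq_fun do rewrite big_nil; exact: sq_integrable_cst.
by under eq_fun do rewrite big_cons; exact: sq_integrableD.
Qed.

Definition sq_integrable_vec n (f : T -> 'cV[R]_n) :=
  forall i, sq_integrable (fun t => f t i ord0).

Lemma sq_integrable_vecD n (f h : T -> 'cV[R]_n) :
  sq_integrable_vec f -> sq_integrable_vec h ->
  sq_integrable_vec (fun t => f t + h t).
Proof.
by move=> lf lh i; under eq_fun do rewrite mxE; exact: sq_integrableD.
Qed.

Lemma sq_integrable_vecM m n (M : 'M[R]_(m, n)) (f : T -> 'cV[R]_n) :
  sq_integrable_vec f -> sq_integrable_vec (fun t => M *m f t).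
Proof.
move=> lf i; under eq_fun do rewrite mxE.
by apply: sq_integrable_sum => j; exact: sq_integrableZ.
Qed.

Lemma sq_integrable_vec_cst n (c : 'cV[R]_n) : sq_integrable_vec (fun=> c).
Proof. by move=> i; exact: sq_integrable_cst. Qed.

Lemma sq_integrable_bl m n (M : 'M[R]_(m, n)) (y : T -> 'cV[R]_m)
    (z : T -> 'cV[R]_n) : sq_integrable_vec y -> sq_integrable_vec z ->
  integrable1 (fun t => bl M (y t) (z t)).
Proof.
move=> ly lz; under eq_fun do rewrite blE.
apply: integrable1_sum => i; apply: integrable1_sum => j.
under eq_fun do rewrite -mulrA.
by apply: integrable1Z; exact: sq_integrable_mul.
Qed.

Lemma sq_integrable_quad n (M : 'M[R]_n) (y : T -> 'cV[R]_n) :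
  sq_integrable_vec y -> integrable1 (fun t => quad M (y t)).
Proof. by move=> ly; exact: sq_integrable_bl. Qed.

Lemma posdef_sq_integrable n (M : 'M[R]_n) (y : T -> 'cV[R]_n) : posdef M ->
  measurable_fun setT y -> integrable1 (fun t => quad M (y t)) ->
  sq_integrable_vec y.
Proof.
move=> pM my iq i.
have mi : measurable_fun setT (fun t => y t i ord0).
  exact: (measurableT_comp (measurable_entry _ _) my).
split=> //; have [c c0 hc] := sqr_coord_le i pM.
apply: integrable1_le (integrable1Z c iq) _; first exact: measurable_funX.
by move=> t; rewrite ger0_norm ?sqr_ge0.
Qed.

End square_integrable.

(** * Independence *)

Section restriction.
Context {d : measure_display} {T : measurableType d} {R : realType}.
Variable mu : {measure set T -> \bar R}.

(** On C the restricted measure agrees with [mu]; on the complement it is zero. *)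
Lemma ge0_integral_mrestr (C : set T) (mC : measurable C) (f : T -> \bar R) :
  measurable_fun setT f -> (forall t, (0 <= f t)%E) ->
  (\int[mrestr mu mC]_t f t = \int[mu]_(t in C) f t)%E.
Proof.
move=> mf f0; have mC' : measurable (~` C) by exact: measurableC.
have mfD D : measurable_fun D f by exact: measurable_funTS.
rewrite -(setvU C) ge0_integral_setU //; last first.
  by apply/disj_setPRL; rewrite setCK.
rewrite [X in (X + _)%E](@eq_measure_integral _ _ _ _ mzero) => [|A mA AC].
  rewrite integral_measure_zero add0e.
  by apply: eq_measure_integral => A mA AC; rewrite /= /mrestr setIidl.
by rewrite /= /mrestr (disjoints_subset A C).2 ?measure0.
Qed.

End restriction.

Section independence.
Context {d : measure_display} {T : measurableType d} {R : realType}.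
Variable Pr : probability T R.
Context {dV : measure_display} {V : measurableType dV}.

Definition event_independent (Z : T -> V) (C : set T) : Prop :=
  forall F, measurable F -> Pr (C `&` Z @^-1` F) = (Pr C * Pr (Z @^-1` F))%E.

(** Independence says that the law of Z under the restriction of [Pr] to C is [Pr C] times its law
    under [Pr]; integrate f against both. *)
Lemma ge0_event_independent_integral (Z : {mfun T >-> V}) (C : set T) (f : V -> \bar R) :
  measurable C -> event_independent Z C -> measurable_fun setT f ->
  (forall z, (0 <= f z)%E) ->
  (\int[Pr]_(t in C) f (Z t) = Pr C * \int[Pr]_t f (Z t))%E.
Proof.
move=> mC iC mf f0.
have fin : Pr C \is a fin_num by rewrite fin_num_measure.
pose p := NngNum (fine_ge0 (measure_ge0 Pr C)).
have mfZ : measurable_fun setT (fun t => f (Z t)) by exact: measurableT_comp.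
rewrite -ge0_integral_mrestr //.
have h (m : {measure set T -> \bar R}) :
    (\int[m]_t f (Z t) = \int[pushforward m Z]_y f y)%E.
  by rewrite ge0_integral_pushforward.
rewrite !h (@eq_measure_integral _ _ _ _ (mscale p (pushforward Pr Z))).
  by rewrite ge0_integral_mscale //= fineK.
by move=> F mF _; rewrite /= /pushforward /mrestr /mscale /= fineK // setIC iC.
Qed.

Lemma event_independent_integral (Z : {mfun T >-> V}) (C : set T) (f : V -> R) :
  measurable C -> event_independent Z C -> measurable_fun setT f ->
  Pr.-integrable setT (fun t => (f (Z t))%:E) -> (\int[Pr]_t (f (Z t))%:E = 0)%E ->
  (\int[Pr]_(t in C) (f (Z t))%:E = 0)%E.
Proof.
move=> mC iC mf iF Ef0; pose fE z := (f z)%:E.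
have mE : measurable_fun setT fE by exact/measurable_EFinP.
have hp : (fun t => (f (Z t))%:E)^\+%E = (fun t => fE^\+%E (Z t)).
  exact: (funepos_comp fE Z).
have hn : (fun t => (f (Z t))%:E)^\-%E = (fun t => fE^\-%E (Z t)).
  exact: (funeneg_comp fE Z).
have E D : (\int[Pr]_(t in D) (f (Z t))%:E = \int[Pr]_(t in D) fE^\+ (Z t)
    - \int[Pr]_(t in D) fE^\- (Z t))%E.
  by rewrite [LHS]integralE hp hn.
have dE : ((\int[Pr]_t fE^\+ (Z t)) +? - (\int[Pr]_t fE^\- (Z t)))%E.
  by have := integrable_add_def measurableT iF; rewrite hp hn.
move: Ef0; rewrite (E C) (E setT).
rewrite !(ge0_event_independent_integral mC iC) //; last 2 first.
- exact: measurable_funeneg.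
- exact: measurable_funepos.
by move=> Ef0; rewrite -muleBr ?fin_num_measure // Ef0 mule0.
Qed.


Variables (I : eqType) (Z : I -> T -> V) (s : seq I).
Hypotheses (mZ : forall i, measurable_fun setT (Z i)).

(** A family closed under intersection that generates the sigma-algebra of the variables indexed by
    s, ready for a Dynkin argument. *)
Definition cylinders : set (set T) :=
  [set C | exists2 F : I -> set V, (forall i, measurable (F i)) &
    C = \bigcap_(i in [set` s]) Z i @^-1` F i].

Lemma measurable_cylinders C : <<s cylinders >> C -> measurable C.
Proof.
apply: smallest_sub; first exact: sigma_algebra_measurable.
move=> _ [F mF ->]; apply: fin_bigcap_measurable => // i _.
by have := mZ i measurableT (mF i); rewrite setTI.
Qed.

Lemma cylinders_setI_closed : setI_closed cylinders.
Proof.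
move=> _ _ [F mF ->] [G mG ->]; exists (fun i => F i `&` G i).
  by move=> i; exact: measurableI.
by rewrite -bigcapI.
Qed.

Lemma measurable_prefix i : i \in s ->
  measurable_fun setT (Z i : g_sigma_algebraType cylinders -> V).
Proof.
move=> si _ F mF; rewrite setTI; apply: sub_sigma_algebra.
exists (fun j => if j == i then F else setT).
  by move=> j; case: ifP.
apply/seteqP; split=> [t Ft j _|t /(_ i si)] /=; last by rewrite eqxx.
by case: eqP => [->|].
Qed.

Lemma prefix_event_independent i C : mutually_independent Pr Z ->
  uniq s -> i \notin s -> <<s cylinders >> C -> event_independent (Z i) C.
Proof.
move=> hZ us nis sC F mF; set D := Z i @^-1` F.
have mD : measurable D by have := mZ i measurableT mF; rewrite setTI.
have PD : Pr D \is a fin_num by rewrite fin_num_measure.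
move: C sC; apply: (@dynkin_induction _ (g_sigma_algebraType cylinders) cylinders
  (fun C => Pr (C `&` D) = (Pr C * Pr D)%E)) => //.
- exact: cylinders_setI_closed.
- by rewrite setTI probability_setT mul1e.
- move=> _ [G mG ->].
  (* As i is not in s, inserting F at i changes no factor over s, so one family serves the product
     formula for both s and i :: s. *)
  pose F' j := if j == i then F else G j.
  have mF' j : measurable (F' j) by rewrite /F'; case: ifP.
  have eG : \bigcap_(j in [set` s]) Z j @^-1` F' j
      = \bigcap_(j in [set` s]) Z j @^-1` G j.
    apply: eq_bigcapr => j /= js; rewrite /F'; case: eqP => // ji.
    by rewrite -ji js in nis.
  have := hZ (i :: s) F'; rewrite /= nis us => /(_ isT (fun j _ => mF' j)).
  have -> : \bigcap_(j in [set` i :: s]) Z j @^-1` F' j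
      = (\bigcap_(j in [set` s]) Z j @^-1` F' j) `&` D.
    apply/seteqP; split=> [t ht|t [ht Dt] j /=].
      split=> [j js|]; first by apply: ht; rewrite /= inE js orbT.
      by have := ht i; rewrite /F' /= eqxx inE eqxx; exact.
    by rewrite inE => /predU1P[->|/ht//]; rewrite /F' eqxx.
  rewrite big_cons {2}/F' eqxx eG => ->.
  by rewrite muleC -(hZ s F' us (fun j _ => mF' j)) eG.
- move=> S /measurable_cylinders mS PS.
  have -> : ~` S `&` D = D `\` S by rewrite setIC.
  rewrite measureD //; last by rewrite -ge0_fin_numE.
  rewrite (probability_setC _ mS) muleBl ?mul1e ?fin_num_adde_defr //.
  by congr (_ - _)%E; rewrite setIC; exact: PS.
- move=> G mG tG PG.
  have mG' n : d.-measurable (G n) by apply: measurable_cylinders; exact: mG.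
  rewrite setI_bigcupl measure_bigcup //=; last 2 first.
  + by move=> n _; exact: measurableI.
  + exact: trivIset_setIr.
  rewrite measure_bigcup // -[in RHS](fineK PD) muleC -nneseriesZl // fineK //.
  by apply: eq_eseriesr => n _; rewrite PG muleC.
Qed.

End independence.

(** * Expected costs *)

Section stochastic_loop.
Context {d : measure_display} {T : measurableType d} {R : realType}.
Variable Pr : probability T R.
Context {nx nu : nat}.
Variables (A : 'M[R]_nx) (B : 'M[R]_(nx, nu)).
Variables (x0 : {RV Pr >-> 'cV[R]_nx}) (W : nat -> {RV Pr >-> 'cV[R]_nx}).
Variables (Q : 'M[R]_nx) (Rc : 'M[R]_nu) (g lam : R).
Hypotheses (hQ : psd Q) (hR : posdef Rc) (lam0 : 0 < lam) (g01 : 0 < g < 1).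

Let g0 : 0 <= g. Proof. by case/andP: g01 => /ltW. Qed.

Section centered.
Variables (n : nat) (Y : T -> 'cV[R]_n) (K : 'M[R]_n).
Hypothesis hY : centered_with_covariance Pr Y K.

Lemma centered_sq_integrable : sq_integrable_vec Pr Y.
Proof.
move=> i; have [lY _] := hY; split; last exact: Lfun2_integrable_sqr.
by have := lY i; rewrite inE => /andP[]; rewrite inE.
Qed.

Lemma centered_mean i : (\int[Pr]_t (Y t i ord0)%:E = 0)%E.
Proof. by have [_ [mY _]] := hY; have := mY i; rewrite unlock. Qed.

Lemma centered_second_moment i : \int[Pr]_t (Y t i ord0 ^+ 2) = K i i.
Proof.
have [lY [mY cY]] := hY.
have l1 : (fun w => Y w i ord0) \in Lfun Pr 1.
  by apply/Lfun1_integrable; exact/sq_integrable_integrable/centered_sq_integrable.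
have := cY i i; rewrite covarianceE // ?mY ?mule0 ?sube0; last first.
  exact: Lfun2_mul_Lfun1.
by rewrite /Rintegral unlock => ->.
Qed.

Lemma centered_quad1 : \int[Pr]_t quad 1%:M (Y t) = \tr K.
Proof.
under eq_Rintegral do rewrite quad1E.
rewrite RintegralT_sum => [|i]; last by case: (centered_sq_integrable i).
by apply: eq_bigr => i _; exact: centered_second_moment.
Qed.

End centered.

Section cost.
Variables (mc : cpolicy R nx nu) (ms : spolicy R nx nu).
Hypotheses (hmc : policies_C mc) (hms : policies_S ms).

Definition loop_x k t := state A B mc ms (x0 t) (W ^~ t) k.
Definition loop_u k t := control A B mc ms (x0 t) (W ^~ t) k.
Definition loop_a k t := schedule A B mc ms (x0 t) (W ^~ t) k.
Definition loop_I k t := cinfo_at A B mc ms (x0 t) (W ^~ t) k.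

Lemma loop_xS t k : loop_x k.+1 t = A *m loop_x k t + B *m loop_u k t + W k t.
Proof. exact: stateS. Qed.

Lemma loop_measurable k : [/\ measurable_fun setT (loop_x k),
  measurable_fun setT (loop_u k), measurable_fun setT (loop_a k)
  & measurable_fun setT (loop_I k)].
Proof.
have [hX hU hA hI] := @measurable_loop _ _ _ A B mc ms hmc hms _ _ x0
  (fun j => W j) k (measurable_funPT x0) (fun j _ => measurable_funPT (W j)).
by split; [exact: hX|exact: hU|exact: hA|exact: hI].
Qed.

Definition stage_cost k t : R :=
  g ^+ k * (quad Q (loop_x k t) + quad Rc (loop_u k t) + lam * (loop_a k t)%:R).

Lemma stage_cost_ge0 k t : 0 <= stage_cost k t.
Proof.
rewrite mulr_ge0 ?exprn_ge0 // !addr_ge0 ?(proj2 hQ) ?(proj2 (psd_posdef hR)) //.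
by rewrite mulr_ge0 ?(ltW lam0).
Qed.

Lemma measurable_stage_cost k : measurable_fun setT (stage_cost k).
Proof.
have [mx mu ma _] := loop_measurable k.
apply: measurable_funM; first exact: measurable_cst.
apply: measurable_funD; first apply: measurable_funD.
- exact: measurable_bl.
- exact: measurable_bl.
- apply: measurable_funM; first exact: measurable_cst.
  exact: (measurableT_comp (f := fun b : bool => b%:R : R)).
Qed.

Lemma measurable_total_cost N :
  measurable_fun setT (fun t => \sum_(j < N) stage_cost j t).
Proof. by apply: measurable_sum => j; exact: measurable_stage_cost. Qed.

Local Notation Jm := (J Pr A B Q Rc g lam x0 (fun k => W k) mc ms).

Lemma cost_series : (Jm = \sum_(0 <= k <oo) \int[Pr]_t (stage_cost k t)%:E)%E.
Proof.
rewrite /J -integral_nneseries //.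
- by move=> k; apply/measurable_EFinP; exact: measurable_stage_cost.
- by move=> k t _; rewrite lee_fin stage_cost_ge0.
Qed.

Lemma total_cost_int N : (\int[Pr]_t (\sum_(j < N) stage_cost j t)%:E
  = \sum_(0 <= k < N) \int[Pr]_t (stage_cost k t)%:E)%E.
Proof.
rewrite -ge0_integral_sum //.
- by apply: eq_integral => t _; rewrite sumEFin big_mkord.
- by move=> k; apply/measurable_EFinP; exact: measurable_stage_cost.
- by move=> k t _; rewrite lee_fin stage_cost_ge0.
Qed.

Lemma total_cost_le N : (\int[Pr]_t (\sum_(j < N) stage_cost j t)%:E <= Jm)%E.
Proof.
rewrite total_cost_int cost_series; apply: nneseries_lim_ge => k _ _.
by apply: integral_ge0 => t _; rewrite lee_fin stage_cost_ge0.
Qed.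

(** Together with [total_cost_le] this makes J the supremum of the mean partial costs, so later
    estimates can stay at finite horizons. *)
Lemma cost_le M :
  (forall N, (\int[Pr]_t (\sum_(j < N) stage_cost j t)%:E <= M)%E) -> (Jm <= M)%E.
Proof.
move=> h; rewrite cost_series; apply: lime_le.
  apply: is_cvg_nneseries => k _ _.
  by apply: integral_ge0 => t _; rewrite lee_fin stage_cost_ge0.
by apply: nearW => N; rewrite -total_cost_int.
Qed.

End cost.

(** * A pair of policies with finite cost *)

Section finite_cost.
Variables (K0 KW : 'M[R]_nx).
Hypotheses (hx0 : centered_with_covariance Pr x0 K0).
Hypotheses (hW : forall k, centered_with_covariance Pr (W k) KW).
Hypothesis hAB : controllable A B.

Let P := riccati_sol g A B 1%:M Rc.
Let L := gain g A B Rc P.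

(** Under permanent transmission the default 0 is used at time 0 only, where the information is
    empty. *)
Definition stab_C : cpolicy R nx nu := fun j i => - (L *m odflt 0 (i.1 j)).
Definition full_S : spolicy R nx nu := fun _ _ => true.

Lemma stab_C_policy : policies_C stab_C.
Proof.
move=> j; rewrite /stab_C.
under eq_fun do rewrite -mulNmx.
apply: measurable_mulmx_l.
apply: (measurableT_comp (measurable_odflt _)).
exact: (measurableT_comp (measurable_seq_entry j) measurable_fst).
Qed.

Lemma full_S_policy : policies_S full_S.
Proof. by move=> j; exact: measurable_cst. Qed.

Lemma stab_control x w k : (0 < k)%N ->
  control A B stab_C full_S x w k = - (L *m state A B stab_C full_S x w k).
Proof.
move=> k0; rewrite controlE /stab_C /cinfo_at /info_C /= k0 leqnn /=.
by rewrite scheduleE.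
Qed.

Let psd1 n : psd (1%:M : 'M[R]_n) := psd_posdef (posdef1 n).
Let pP : psd P := psd_riccati_sol g01 hR (psd1 nx) hAB.

(* P solves the Riccati equation for the weight 1, so that its quadratic form
   is a strict Lyapunov function of the closed loop with gain L. *)
Lemma lyapunov_step : exists2 C : R, 0 <= C & forall x w,
  g * quad P (A *m x - B *m (L *m x) + w)
  <= quad P x - 2^-1 * quad 1%:M x + C * quad 1%:M w.
Proof.
have rP := riccati_solP g01 hR (psd1 nx) hAB.
have [c c0 hc] := quad_le P (posdef1 nx).
(* Parameter of Young's inequality for P at y + w. Since e c <= 1/2, inflating P by 1 + e consumes
   at most half of the decrease |x|^2. *)
pose e := (2 * (c + 1))^-1.
have e0 : 0 < e by rewrite invr_gt0 mulr_gt0 // ltr_wpDl.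
exists (g * (1 + e^-1) * c) => [|x w].
  by rewrite !mulr_ge0 // addr_ge0 // invr_ge0 ltW.
set y := A *m x - _.
have hy : g * quad P y <= quad P x - quad 1%:M x.
  have := riccati_quad A B 1%:M g0 hR x (- (L *m x)) pP.
  rewrite (esym rP : riccati_map g A B 1%:M Rc P = P) -/L addNr.
  rewrite [quad _ 0]quadE bl0l addr0 mulmxN -/y => <-.
  by have := proj2 (psd_posdef hR) (- (L *m x)); lra.
have hyw : quad P (y + w) <= (1 + e) * quad P y + (1 + e^-1) * quad P w.
  have h : 0 <= e * (e * quad P y) - 2 * (e * bl P y w) + quad P w.
    have := proj2 pP (e *: y - w); rewrite quadD ?(proj1 pP) // !quadE.
    by rewrite !(blZl, blZr, blNl, blNr) opprK; lra.
  rewrite quadD ?(proj1 pP) //.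
  have ei : 0 <= e^-1 by rewrite invr_ge0 ltW.
  have := mulr_ge0 ei h.
  have -> : e^-1 * (e * (e * quad P y) - 2 * (e * bl P y w) + quad P w)
      = e * quad P y - 2 * bl P y w + e^-1 * quad P w.
    move: (quad P y) (bl P y w) (quad P w) => a b p.
    by clearbody e; field; rewrite gt_eqF.
  lra.
have hcx := hc x; have hcw := hc w; have x1 := proj2 (psd1 nx) x.
have ec : e * c <= 2^-1.
  rewrite /e invfM -mulrA ger_pMr ?invr_gt0 // mulrC ler_pdivrMr ?ltr_wpDl //.
  lra.
have h1 : g * quad P (y + w)
    <= (1 + e) * (g * quad P y) + g * (1 + e^-1) * quad P w.
  have := ler_wpM2l g0 hyw.
  by congr (_ <= _); ring.
apply: le_trans h1 _; apply: lerD; last first.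
  by rewrite -!mulrA ler_wpM2l // ler_wpM2l // addr_ge0 // invr_ge0 ltW.
have := ler_wpM2l (ltW e0) hy; have := ler_wpM2l (ltW e0) hcx.
have := ler_wpM2r x1 ec.
have := mulr_ge0 (ltW e0) x1.
lra.
Qed.

Lemma stab_path_cost : exists2 K : R, 0 <= K & forall t N,
  \sum_(j < N) stage_cost stab_C full_S j t
  <= K * (quad 1%:M (x0 t) + \sum_(j < N) g ^+ j * (quad 1%:M (W j t) + 1)).
Proof.
have [C C0 hC] := lyapunov_step.
have [c1 c10 h1] := quad_le (Q + L^T *m Rc *m L) (posdef1 nx).
have [c2 c20 h2] := quad_le Q (posdef1 nx).
have [c3 c30 h3] := quad_le (A^T *m P *m A) (posdef1 nx).
have [c4 c40 h4] := quad_le P (posdef1 nx).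
have l0 := ltW lam0.
(* The weight of the Lyapunov function: its decrease K1 |x|^2 / 2 pays exactly for the stage cost c1
   |x|^2. *)
pose K1 := 2 * c1.
have K10 : 0 <= K1 by rewrite mulr_ge0.
(* c2 covers the state cost at time 0, the next two terms the Lyapunov function at x_1, [lam] the
   transmissions and K1 C the noise. *)
pose K := c2 + 2 * (K1 * (g * c3)) + 2 * (K1 * (g * c4)) + lam + K1 * C.
have [q1 q2 q3] : [/\ 0 <= K1 * (g * c3), 0 <= K1 * (g * c4) & 0 <= K1 * C].
  by rewrite !mulr_ge0.
exists K => [|t N]; first by rewrite /K; lra.
set x := loop_x stab_C full_S ^~ t.
set u := loop_u stab_C full_S ^~ t.
pose n1 y := quad (1%:M : 'M[R]_nx) y.
have n10 y : 0 <= n1 y by exact: (proj2 (psd1 nx)).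
(* The induction starts at horizon 1, because the control at time 0 is 0 and not the feedback. *)
suff : N = 0%N \/ \sum_(j < N) stage_cost stab_C full_S j t
    + K1 * (g ^+ N * quad P (x N))
    <= K * (n1 (x0 t) + \sum_(j < N) g ^+ j * (n1 (W j t) + 1)).
  case=> [->|]; first by rewrite !big_ord0 addr0 mulr_ge0 ?n10 // /K; lra.
  apply: le_trans; rewrite lerDl mulr_ge0 // mulr_ge0 ?exprn_ge0 //.
  exact: (proj2 pP).
have cost_k k : stage_cost stab_C full_S k t
    = g ^+ k * (quad Q (x k) + quad Rc (u k) + lam).
  rewrite /stage_cost /loop_a scheduleE /= mulr1; congr (_ * _).
elim: N => [|N IH]; [by left|right].
case: N IH => [_|N [//|IH]].
  rewrite !big_ord1 cost_k expr0 expr1 !mul1r.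
  have x1 : x 1%N = A *m x0 t + W 0%N t.
    rewrite /x loop_xS /loop_u controlE /stab_C /= mulmx0 oppr0 mulmx0 addr0.
    by [].
  have -> : u 0%N = 0.
    by rewrite /u /loop_u controlE /stab_C /= mulmx0 oppr0.
  rewrite [quad Rc 0]quadE bl0l addr0.
  have := psd_quadD_le (A *m x0 t) (W 0%N t) pP.
  rewrite -x1 [quad P (A *m _)]quadE bl_mull bl_mulr -quadE => hx.
  have -> : x 0%N = x0 t by [].
  have := h2 (x0 t); have := h3 (x0 t); have := h4 (W 0%N t).
  rewrite -!/(n1 _) => e4 e3 e2.
  have hx' : K1 * (g * quad P (x 1%N))
      <= K1 * (g * (2 * (c3 * n1 (x0 t)) + 2 * (c4 * n1 (W 0%N t)))).
    rewrite ler_wpM2l // ler_wpM2l //; apply: le_trans hx _; lra.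
  have := n10 (x0 t); have := n10 (W 0%N t).
  move: hx' e2; move: (n1 (x0 t)) (n1 (W 0%N t)) (quad Q _) (quad P _).
  move=> a b q p hx' e2 b0 a0; rewrite /K.
  have := mulr_ge0 q1 b0; have := mulr_ge0 q2 a0; have := mulr_ge0 q3 a0.
  have := mulr_ge0 q3 b0; have := mulr_ge0 l0 b0; have := mulr_ge0 l0 a0.
  have := mulr_ge0 c20 b0.
  lra.
rewrite big_ord_recr [in leRHS]big_ord_recr /=.
set S1 := \sum_(_ < _) _ in IH *; set S2 := \sum_(_ < _) _ in IH *.
set k := N.+1 in IH *; rewrite -/k.
have hu : u k = - (L *m x k) by exact: stab_control.
have hx : x k.+1 = A *m x k - B *m (L *m x k) + W k t.
  by rewrite /x loop_xS -/(u k) hu mulmxN.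
have e1 := hC (x k) (W k t); rewrite -hx -!/(n1 _) in e1.
have e2 : quad Q (x k) + quad Rc (u k) <= c1 * n1 (x k).
  have -> : quad Rc (u k) = quad (L^T *m Rc *m L) (x k).
    by rewrite hu !quadE blNl blNr opprK bl_mull bl_mulr.
  by apply: le_trans (h1 _); rewrite [leRHS]quadE blDM.
have step : g ^+ k * (quad Q (x k) + quad Rc (u k) + lam)
    + K1 * (g ^+ k.+1 * quad P (x k.+1))
    <= K1 * (g ^+ k * quad P (x k)) + g ^+ k * (K * (n1 (W k t) + 1)).
  have -> : K1 * (g ^+ k.+1 * quad P (x k.+1))
      = g ^+ k * (K1 * (g * quad P (x k.+1))) by rewrite exprS; ring.
  have -> : K1 * (g ^+ k * quad P (x k)) = g ^+ k * (K1 * quad P (x k)) by ring.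
  rewrite -!mulrDr ler_wpM2l ?exprn_ge0 //.
  have := ler_wpM2l K10 e1.
  have := n10 (W k t); move: e2; move: (n1 (W k t)) (n1 (x k)).
  move: (quad P (x k)) (quad P (x k.+1)) (quad Q _ + _).
  move=> p p' s b a e2 b0 e3; rewrite /K.
  have := mulr_ge0 q1 b0; have := mulr_ge0 q2 b0; have := mulr_ge0 c20 b0.
  have := mulr_ge0 l0 b0.
  have ca : c1 * a = K1 * (2^-1 * a) by rewrite /K1; field.
  rewrite ca in e2.
  clearbody K1; lra.
rewrite cost_k -/k; move: IH step; rewrite -/(n1 (x0 t)) -!/(n1 (W _ t)).
have -> : K * (n1 (x0 t) + (S2 + g ^+ k * (n1 (W k t) + 1)))
  = K * (n1 (x0 t) + S2) + g ^+ k * (K * (n1 (W k t) + 1)) by ring.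
clearbody K S1 S2; lra.
Qed.

Lemma geometric_sum_le N : \sum_(j < N) g ^+ j <= (1 - g)^-1.
Proof.
have /andP[_ g1] := g01.
rewrite -[leRHS]mul1r ler_pdivlMr ?subr_gt0 //.
have := subrX1 g N; have := exprn_ge0 N g0; lra.
Qed.

Lemma finite_cost_pair : exists mc ms, [/\ policies_C mc, policies_S ms
  & (J Pr A B Q Rc g lam x0 (fun k => W k) mc ms < +oo)%E].
Proof.
exists stab_C, full_S; split; [exact: stab_C_policy|exact: full_S_policy|].
have [K K_ge0 hK] := stab_path_cost.
have iW k : integrable1 Pr (fun t => quad 1%:M (W k t)).
  exact: sq_integrable_quad (centered_sq_integrable (hW k)).
have ix : integrable1 Pr (fun t => quad 1%:M (x0 t)).
  exact: sq_integrable_quad (centered_sq_integrable hx0).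
have iS k : integrable1 Pr (fun t => g ^+ k * (quad 1%:M (W k t) + 1)).
  by apply: integrable1Z; apply: integrable1D => //; exact: integrable1_cst.
have tr0 : 0 <= \tr KW.
  rewrite -(centered_quad1 (hW 0)); apply: Rintegral_ge0 => t _.
  exact: (proj2 (psd1 nx)).
apply: le_lt_trans (ltry (K * (\tr K0 + (1 - g)^-1 * (\tr KW + 1)))).
apply: cost_le; [exact: stab_C_policy|exact: full_S_policy|move=> N].
pose r t := K * (quad 1%:M (x0 t) + \sum_(j < N) g ^+ j * (quad 1%:M (W j t) + 1)).
have iR : integrable1 Pr (fun t => quad 1%:M (x0 t)
    + \sum_(j < N) g ^+ j * (quad 1%:M (W j t) + 1)).
  by apply: integrable1D => //; exact: integrable1_sum.
apply: (@le_trans _ _ (\int[Pr]_t (r t)%:E)%E).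
  apply: ge0_le_integral => //.
  - by move=> t _; rewrite lee_fin sumr_ge0 // => j _; exact: stage_cost_ge0.
  - apply/measurable_EFinP; apply: measurable_total_cost.
      exact: stab_C_policy.
    exact: full_S_policy.
  - by apply/measurable_EFinP/(integrable1_measurable (Pr := Pr)); exact: integrable1Z.
  - by move=> t _; rewrite lee_fin; exact: hK.
rewrite -EFin_Rintegral //; last exact: integrable1Z.
rewrite lee_fin RintegralT_Z // ler_wpM2l //.
rewrite RintegralT_D //; last exact: integrable1_sum.
rewrite (centered_quad1 hx0) lerD2l RintegralT_sum //.
have -> : \sum_(j < N) \int[Pr]_t (g ^+ j * (quad 1%:M (W j t) + 1))
    = (\sum_(j < N) g ^+ j) * (\tr KW + 1).
  rewrite mulr_suml; apply: eq_bigr => j _.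
  rewrite RintegralT_Z; last by apply: integrable1D => //; exact: integrable1_cst.
  rewrite RintegralT_D //; last exact: integrable1_cst.
  by rewrite (centered_quad1 (hW j)) RintegralT_cst.
by rewrite ler_wpM2r ?geometric_sum_le // addr_ge0.
Qed.

End finite_cost.

(** * Independence of the noise from past information *)

Section noise.
Variables (mc : cpolicy R nx nu) (ms : spolicy R nx nu).
Hypotheses (hmc : policies_C mc) (hms : policies_S ms).
Hypothesis hind : mutually_independent Pr
  (fun o : option nat => if o is Some k then W k : T -> 'cV[R]_nx else x0).

(** The list [s] names x_0 and W_0, ..., W_{k-1}. The loop is measurable for the sigma-algebra they
    generate, and the index of W_j is not in [s] when j >= k. *)
Lemma past_noise_independent k j E : (k <= j)%N -> measurable E ->
  event_independent Pr (W j) (loop_I mc ms k @^-1` E).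
Proof.
move=> kj mE.
pose Z (o : option nat) : T -> 'cV[R]_nx :=
  if o is Some k then W k : T -> 'cV[R]_nx else x0.
pose s := None :: map Some (iota 0 k).
have mZ o : measurable_fun setT (Z o) by case: o => [i|]; exact: measurable_funPT.
apply: (@prefix_event_independent _ _ _ Pr _ _ _ Z s mZ (Some j)) => //.
- by rewrite /= map_inj_uniq ?iota_uniq ?andbT; [apply/negP => /mapP[]|move=> ? ? []].
- rewrite inE /= mem_map ?mem_iota ?add0n -?leqNgt //.
- have := @measurable_loop _ _ _ A B mc ms hmc hms _
    (g_sigma_algebraType (cylinders Z s)) (Z None) (fun i => Z (Some i)) k.
  case=> [||_ _ _ hI].
  + by apply: measurable_prefix; rewrite inE.
  + move=> i ik; apply: measurable_prefix.
    by rewrite inE /= mem_map ?mem_iota ?add0n // => ? ? [].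
  + by have := hI k (leqnn _) measurableT E mE; rewrite setTI.
Qed.

Lemma past_noise_integral KW k j E i :
  centered_with_covariance Pr (W j) KW -> (k <= j)%N -> measurable E ->
  \int[Pr]_(t in loop_I mc ms k @^-1` E) W j t i ord0 = 0.
Proof.
move=> hW kj mE.
have [_ _ _ mI] := loop_measurable hmc hms k.
have mS : measurable (loop_I mc ms k @^-1` E).
  by have := mI measurableT E mE; rewrite setTI.
rewrite /Rintegral.
rewrite (@event_independent_integral _ _ _ Pr _ _ (W j) _
  (fun z : 'cV[R]_nx => z i ord0)) //.
- exact: past_noise_independent.
- exact: measurable_entry.
- exact/(sq_integrable_integrable (Pr := Pr))/(centered_sq_integrable hW).
- exact: (centered_mean hW).
Qed.

End noise.

End stochastic_loop.

(** * The first-order condition *)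

Section optimality.
Context {d : measure_display} {T : measurableType d} {R : realType}.
Variable Pr : probability T R.
Context {nx nu : nat}.
Variables (A : 'M[R]_nx) (B : 'M[R]_(nx, nu)).
Variables (x0 : {RV Pr >-> 'cV[R]_nx}) (W : nat -> {RV Pr >-> 'cV[R]_nx}).
Variables (Q Qh : 'M[R]_nx) (Rc : 'M[R]_nu) (g lam : R) (K0 KW : 'M[R]_nx).
Hypotheses (hQ : psd Q) (hR : posdef Rc) (lam0 : 0 < lam) (g01 : 0 < g < 1).
Hypotheses (hQh : psd_sqrt_of Qh Q) (hAQ : observable A Qh).
Hypotheses (hx0 : centered_with_covariance Pr x0 K0).
Hypotheses (hW : forall k, centered_with_covariance Pr (W k) KW).
Hypothesis hind : mutually_independent Pr
  (fun o : option nat => if o is Some k then W k : T -> 'cV[R]_nx else x0).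
Variables (mc : cpolicy R nx nu) (ms : spolicy R nx nu).
Hypotheses (hmc : policies_C mc) (hms : policies_S ms).

Let g_gt0 : 0 < g. Proof. by case/andP: g01. Qed.
Let g0 : 0 <= g. Proof. exact: ltW. Qed.

Local Notation X := (loop_x A B x0 W mc ms).
Local Notation U := (loop_u A B x0 W mc ms).
Local Notation I := (loop_I A B x0 W mc ms).
Local Notation c := (stage_cost A B x0 W Q Rc g lam mc ms).
Local Notation JJ := (J Pr A B Q Rc g lam x0 (fun k => W k)).

Hypothesis Jfin : (JJ mc ms < +oo)%E.

Let c0 k t : 0 <= c k t. Proof. exact: stage_cost_ge0. Qed.

Lemma integrable1_ge0 (f : T -> R) : measurable_fun setT f ->
  (forall t, 0 <= f t) -> (\int[Pr]_t (f t)%:E < +oo)%E -> integrable1 Pr f.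
Proof.
move=> mf f0 If; apply/integrableP; split; first exact/measurable_EFinP.
by under eq_integral do rewrite gee0_abs ?lee_fin //.
Qed.

Lemma integrable_total_cost N : integrable1 Pr (fun t => \sum_(j < N) c j t).
Proof.
apply: integrable1_ge0.
- exact: measurable_total_cost.
- by move=> t; exact: sumr_ge0.
- by apply: le_lt_trans Jfin; exact: total_cost_le.
Qed.

Lemma integrable_stage_cost k : integrable1 Pr (c k).
Proof.
apply: integrable1_le (integrable_total_cost k.+1) _.
  exact: measurable_stage_cost.
move=> t; rewrite ger0_norm // big_ord_recr /= lerDr.
exact: sumr_ge0.
Qed.

Lemma fin_num_cost : JJ mc ms \is a fin_num.
Proof.
rewrite ge0_fin_numE //; apply: integral_ge0 => t _.
by apply: nneseries_ge0 => k _ _; rewrite lee_fin; exact: c0.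
Qed.

Lemma mean_total_cost_le N :
  \int[Pr]_t (\sum_(j < N) c j t) <= fine (JJ mc ms).
Proof.
rewrite -lee_fin EFin_Rintegral //; last exact: integrable_total_cost.
rewrite fineK ?fin_num_cost //; exact: total_cost_le.
Qed.

Lemma stage_quad_le k t : g ^+ k * (quad Q (X k t) + quad Rc (U k t)) <= c k t.
Proof.
by rewrite /stage_cost ler_wpM2l ?exprn_ge0 // lerDl mulr_ge0 // ltW.
Qed.

Lemma sq_integrable_control k : sq_integrable_vec Pr (U k).
Proof.
have [_ mU _ _] := loop_measurable A B x0 W hmc hms k.
apply: (posdef_sq_integrable hR) => //.
apply: integrable1_le (integrable1Z (g ^- k) (integrable_stage_cost k)) _.
  exact: measurable_bl.
move=> t; rewrite ger0_norm ?(proj2 (psd_posdef hR)) //.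
rewrite mulrC ler_pdivlMr ?exprn_gt0 // mulrC.
apply: le_trans (stage_quad_le k t); rewrite ler_wpM2l ?exprn_ge0 //.
by rewrite lerDr (proj2 hQ).
Qed.

(** The stage cost need not dominate the state, so its second moment is propagated through the
    dynamics from those of the controls and noises. *)
Lemma sq_integrable_state k : sq_integrable_vec Pr (X k).
Proof.
elim: k => [|k IH]; first exact: centered_sq_integrable hx0.
have -> : X k.+1 = (fun t => A *m X k t + B *m U k t + W k t).
  by apply/funext => t; exact: loop_xS.
apply: sq_integrable_vecD; last exact: centered_sq_integrable (hW k).
apply: sq_integrable_vecD; apply: sq_integrable_vecM => //.
exact: sq_integrable_control.
Qed.

Variable P : 'M[R]_nx.
Hypotheses (pP : psd P) (rP : riccati g A B Q Rc P).

Local Notation L := (gain g A B Rc P).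
Local Notation H := (Rhat g B Rc P).

(** [obs_bound] in the mean: finite cost bounds the discounted mean energies, and each noise
    contributes the constant trace of its covariance. *)
Lemma mean_value_tail :
  (fun N => g ^+ N * \int[Pr]_t quad P (X N t)) @ \oo --> (0 : R).
Proof.
have iQ k : integrable1 Pr (fun t => quad Q (X k t)).
  exact/sq_integrable_quad/sq_integrable_state.
have iU k : integrable1 Pr (fun t => quad Rc (U k t)).
  exact/sq_integrable_quad/sq_integrable_control.
have iW k : integrable1 Pr (fun t => quad 1%:M (W k t)).
  exact: sq_integrable_quad (centered_sq_integrable (hW k)).
have iP k : integrable1 Pr (fun t => quad P (X k t)).
  exact/sq_integrable_quad/sq_integrable_state.
pose e k := \int[Pr]_t (quad Q (X k t) + quad Rc (U k t)).
have [n [C C0 hC]] := obs_bound B hR hQ hQh hAQ P.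
apply: (@discounted_tail_cvg0 _ g _ e C (\tr KW) n) => //.
- by move=> N; apply: Rintegral_ge0 => t _; exact: (proj2 pP).
- move=> k; apply: Rintegral_ge0 => t _.
  by rewrite addr_ge0 ?(proj2 hQ) ?(proj2 (psd_posdef hR)).
- exists (fine (JJ mc ms)) => N; apply: le_trans (mean_total_cost_le N).
  rewrite RintegralT_sum => [|k]; last exact: integrable_stage_cost.
  apply: ler_sum => k _; rewrite /e -RintegralT_Z; last exact: integrable1D.
  apply: le_RintegralT; last exact: stage_quad_le.
    by apply: integrable1Z; exact: integrable1D.
  exact: integrable_stage_cost.
- move=> N; pose se j t := stage_energy Q Rc (X ^~ t) (U ^~ t) (fun k => W k t) j.
  have ise j : integrable1 Pr (se j).
    by apply: integrable1D => //; exact: integrable1D.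
  have -> : \sum_(j < n) (e (N + j)%N + \tr KW)
      = \sum_(j < n) \int[Pr]_t se (N + j)%N t.
    apply: eq_bigr => j _; rewrite /se /stage_energy RintegralT_D //; last first.
      exact: integrable1D.
    by rewrite (centered_quad1 (hW _)).
  rewrite -RintegralT_sum // -RintegralT_Z; last exact: integrable1_sum.
  apply: le_RintegralT => //; first by apply: integrable1Z; exact: integrable1_sum.
  by move=> t; apply: hC => j; exact: loop_xS.
Qed.

Section perturbation.
Variables (k : nat) (E : set (cinfo R nx nu)) (v : 'cV[R]_nu).
Hypothesis mE : measurable E.

Let S : set T := I k @^-1` E.
Let mS : measurable S.
Proof.
have [_ _ _ mI] := loop_measurable A B x0 W hmc hms k.
by have := mI measurableT E mE; rewrite setTI.
Qed.

Local Notation xi := (dev_x A B L k v).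
Local Notation mc' := (perturbed_C A B L k v E mc).
Local Notation ms' := (perturbed_S A B L k v E ms).
Local Notation c' := (stage_cost A B x0 W Q Rc g lam mc' ms').

Let first_order t := 2 * bl H (U k t + L *m X k t) v + quad H v.
Let noise N t := \sum_(j < N) g ^+ j.+1 * bl P (W j t) (xi j.+1).

Lemma perturbed_cost_le N t : (k < N)%N ->
  \sum_(j < N) c' j t <= \sum_(j < N) c j t + g ^+ N * quad P (X N t)
    + (t \in S)%:R * (2 * noise N t + g ^+ k * first_order t).
Proof.
move=> kN.
pose b := cinfo_at A B mc ms (x0 t) (fun k => W k t) k \in E.
have pl j : [/\ loop_x A B x0 W mc' ms' j t = X j t + (if b then xi j else 0),
    loop_u A B x0 W mc' ms' j t = U j t + (if b then dev_u A B L k v j else 0)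
    & loop_a A B x0 W mc' ms' j t = loop_a A B x0 W mc ms j t].
  exact: (perturbed_loop A B L k v E mc ms (x0 t) (fun k => W k t) j).
have -> : (t \in S) = b by apply/idP/idP => /set_mem h; exact/mem_set.
have tail0 : 0 <= g ^+ N * quad P (X N t).
  by rewrite mulr_ge0 ?exprn_ge0 // (proj2 pP).
case: b pl => pl; last first.
  rewrite mul0r addr0 -[leLHS]addr0 lerD // le_eqVlt; apply/orP; left; apply/eqP.
  apply: eq_bigr => j _; have [hx hu ha] := pl j.
  by rewrite /stage_cost hx hu ha !addr0.
have dyn j : X j.+1 t = A *m X j t + B *m U j t + W j t by exact: loop_xS.
have := dev_cost_le g0 hR hQ pP rP v dyn kN; rewrite -/(noise N t) => h.
pose ac := \sum_(j < N) g ^+ j * (lam * (loop_a A B x0 W mc ms j t)%:R).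
have -> : \sum_(j < N) c' j t = \sum_(j < N) g ^+ j * (quad Q (X j t + xi j)
    + quad Rc (U j t + dev_u A B L k v j)) + ac.
  rewrite -big_split /=; apply: eq_bigr => j _; have [hx hu ha] := pl j.
  by rewrite /stage_cost hx hu ha -mulrDr.
have -> : \sum_(j < N) c j t = \sum_(j < N) g ^+ j * (quad Q (X j t)
    + quad Rc (U j t)) + ac.
  by rewrite -big_split /=; apply: eq_bigr => j _; rewrite -mulrDr.
rewrite mul1r; move: h; rewrite -/(first_order t); lra.
Qed.

Lemma noise_integral N : \int[Pr]_(t in S) noise N t = 0.
Proof.
have iW j : sq_integrable_vec Pr (W j) := centered_sq_integrable (hW j).
rewrite Rintegral_sum_in // => [|j]; last first.
  by apply: integrable1Z; apply: sq_integrable_bl => //; exact: sq_integrable_vec_cst.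
(* For j < k the deviation at j + 1 <= k is still 0, so only noises independent of I_C(k) remain. *)
rewrite big1 // => j _; have [kj|jk] := leqP k j; last first.
  rewrite dev_x_eq0 //; under eq_Rintegral do rewrite bl0r mulr0.
  by rewrite Rintegral_cst // mul0r.
pose z := g ^+ j.+1 *: (P *m xi j.+1).
have -> : (fun t => g ^+ j.+1 * bl P (W j t) (xi j.+1))
    = (fun t => \sum_i z i ord0 * W j t i ord0).
  apply/funext => t; rewrite /z /bl -mulmxA mxE mulr_sumr.
  by apply: eq_bigr => i _; rewrite !mxE; ring.
rewrite Rintegral_sum_in // => [|i]; last first.
  by apply: integrable1Z; exact: sq_integrable_integrable (iW j i).
rewrite big1 // => i _; rewrite RintegralZl //; last first.
  by apply: (@integrableS _ _ _ _ setT) => //; exact: sq_integrable_integrable (iW j i).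
by rewrite (past_noise_integral A B hmc hms hind i (hW j) kj mE) mulr0.
Qed.

Lemma perturbation_ge0 :
  (forall mc'' ms'', policies_C mc'' -> policies_S ms'' ->
     (JJ mc ms <= JJ mc'' ms'')%E) ->
  0 <= \int[Pr]_(t in S) first_order t.
Proof.
move=> hopt.
have hmc' : policies_C mc' by exact: perturbed_C_policy.
have hms' : policies_S ms' by exact: perturbed_S_policy.
have iW j : sq_integrable_vec Pr (W j) := centered_sq_integrable (hW j).
have iN N : integrable1 Pr (noise N).
  apply: integrable1_sum => j; apply: integrable1Z; apply: sq_integrable_bl => //.
  exact: sq_integrable_vec_cst.
have iF : integrable1 Pr first_order.
  apply: integrable1D; last exact: integrable1_cst.
  apply: integrable1Z; apply: sq_integrable_bl; last exact: sq_integrable_vec_cst.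
  apply: sq_integrable_vecD; first exact: sq_integrable_control.
  by apply: sq_integrable_vecM; exact: sq_integrable_state.
have iP N : integrable1 Pr (fun t => g ^+ N * quad P (X N t)).
  by apply: integrable1Z; exact/sq_integrable_quad/sq_integrable_state.
have iG N : integrable1 Pr (fun t => 2 * noise N t + g ^+ k * first_order t).
  by apply: integrable1D; exact: integrable1Z.
set D := \int[Pr]_(t in S) first_order t.
have hN N : (k < N)%N -> (\int[Pr]_t (\sum_(j < N) c' j t)%:E
    <= (fine (JJ mc ms) + g ^+ k * D + g ^+ N * \int[Pr]_t quad P (X N t))%:E)%E.
  move=> kN.
  pose r t := \sum_(j < N) c j t + g ^+ N * quad P (X N t)
    + (t \in S)%:R * (2 * noise N t + g ^+ k * first_order t).
  have ir1 : integrable1 Pr (fun t => \sum_(j < N) c j t + g ^+ N * quad P (X N t)).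
    by apply: integrable1D => //; exact: integrable_total_cost.
  have ir : integrable1 Pr r by apply: integrable1D => //; exact: integrable1_indic.
  have c'0 t : 0 <= \sum_(j < N) c' j t.
    by apply: sumr_ge0 => j _; exact: stage_cost_ge0.
  apply: (@le_trans _ _ (\int[Pr]_t (r t)%:E)%E).
    apply: ge0_le_integral => //.
    - by move=> t _; rewrite lee_fin.
    - by apply/measurable_EFinP; exact: measurable_total_cost.
    - by apply/measurable_EFinP; exact: integrable1_measurable ir.
    - by move=> t _; rewrite lee_fin; exact: perturbed_cost_le.
  rewrite -EFin_Rintegral // lee_fin RintegralT_D //; last exact: integrable1_indic.
  rewrite RintegralT_D //; last exact: integrable_total_cost.
  rewrite RintegralT_Z; last exact/sq_integrable_quad/sq_integrable_state.
  have iS f : integrable1 Pr f -> Pr.-integrable S (EFin \o f).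
    by move=> h; exact: (integrableS measurableT).
  rewrite Rintegral_indicE.
  rewrite (RintegralD mS (iS _ (integrable1Z 2 (iN N)))
    (iS _ (integrable1Z (g ^+ k) iF))).
  rewrite (RintegralZl _ mS (iS _ (iN N))) (RintegralZl _ mS (iS _ iF)).
  rewrite noise_integral mulr0 add0r -/D.
  by have := mean_total_cost_le N; lra.
have J'le : (JJ mc' ms' <= (fine (JJ mc ms) + g ^+ k * D)%:E)%E.
  (* Two horizons: the mean cost up to N0 is at most the one up to any N >= N0, and letting N grow
     removes the boundary term while N0 stays fixed. *)
  apply: cost_le => // N0.
  have lim : (fun N => fine (JJ mc ms) + g ^+ k * D
      + g ^+ N * \int[Pr]_t quad P (X N t)) @ \oo --> fine (JJ mc ms) + g ^+ k * D + 0.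
    by apply: cvgD; [exact: cvg_cst|exact: mean_value_tail].
  rewrite addr0 in lim.
  have h N : (N0 <= N)%N -> (k < N)%N -> (\int[Pr]_t (\sum_(j < N0) c' j t)%:E
    <= (fine (JJ mc ms) + g ^+ k * D + g ^+ N * \int[Pr]_t quad P (X N t))%:E)%E.
    move=> N0N kN; apply: le_trans (hN N kN).
    rewrite !total_cost_int // (big_cat_nat (leq0n _) N0N) //= leeDl //.
    by apply: sume_ge0 => j _; apply: integral_ge0 => t _; rewrite lee_fin stage_cost_ge0.
  have fin : (\int[Pr]_t (\sum_(j < N0) c' j t)%:E)%E \is a fin_num.
    rewrite ge0_fin_numE; last first.
      apply: integral_ge0 => t _; rewrite lee_fin; apply: sumr_ge0 => j _.
      exact: stage_cost_ge0.
    apply: le_lt_trans (h (maxn N0 k.+1) _ _) (ltry _); first exact: leq_maxl.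
    exact: leq_maxr.
  rewrite -(fineK fin) lee_fin; apply: cvgr_to_ge lim _.
  exists (maxn N0 k.+1) => // N /=; rewrite geq_max => /andP[N0N kN].
  by rewrite -lee_fin fineK //; exact: h.
have := le_trans (hopt _ _ hmc' hms') J'le.
rewrite -[X in (X <= _)%E](fineK fin_num_cost) lee_fin lerDl.
by rewrite pmulr_rge0 // exprn_gt0.
Qed.

End perturbation.

Hypothesis hopt : forall mc'' ms'', policies_C mc'' -> policies_S ms'' ->
     (JJ mc ms <= JJ mc'' ms'')%E.

Lemma optimal_orthogonal k E v : measurable E ->
  \int[Pr]_(t in I k @^-1` E) bl H (U k t + L *m X k t) v = 0.
Proof.
move=> mE; set S := I k @^-1` E.
have [_ _ _ mI] := loop_measurable A B x0 W hmc hms k.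
have mS : measurable S by have := mI measurableT E mE; rewrite setTI.
have iS f : integrable1 Pr f -> Pr.-integrable S (EFin \o f).
  by move=> h; exact: (integrableS measurableT).
have iY : integrable1 Pr (fun t => bl H (U k t + L *m X k t) v).
  apply: sq_integrable_bl; last exact: sq_integrable_vec_cst.
  apply: sq_integrable_vecD; first exact: sq_integrable_control.
  by apply: sq_integrable_vecM; exact: sq_integrable_state.
set a := Rintegral _ _ _; pose b := quad H v * fine (Pr S).
have h (s : R) : 0 <= 2 * (s * a) + s ^+ 2 * b.
  have := perturbation_ge0 k (s *: v) mE hopt; rewrite -/S.
  under eq_Rintegral do rewrite blZr.
  rewrite (RintegralD mS (iS _ (integrable1Z 2 (integrable1Z s iY)))
    (iS _ (integrable1_cst Pr _))).
  rewrite (RintegralZl _ mS (iS _ (integrable1Z s iY))) (RintegralZl _ mS (iS _ iY)).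
  by rewrite Rintegral_cst // -/a quadE blZl blZr -quadE /b; lra.
have b0 : 0 <= b.
  rewrite mulr_ge0 ?fine_ge0 //.
  exact: (proj2 (psd_posdef (posdef_Rhat B g0 hR pP))).
(* A near-minimizer of the quadratic in s; b + 1 is positive even when b = 0, for instance on a null
   event. *)
have := h (- a / (b + 1)).
have -> : 2 * (- a / (b + 1) * a) + (- a / (b + 1)) ^+ 2 * b
    = - (a ^+ 2 * ((b + 2) / (b + 1) ^+ 2)).
  by field; rewrite gt_eqF // ltr_wpDl.
rewrite oppr_ge0 pmulr_lle0; last first.
  by rewrite divr_gt0 ?exprn_gt0 // ltr_wpDl.
move=> a2; apply/eqP; rewrite -sqrf_eq0 eq_le a2; exact: sqr_ge0.
Qed.

(** The vector v = H^-1 e_i turns the pairing in H into the i-th coordinate. *)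
Lemma optimal_mean k E i : measurable E ->
  \int[Pr]_(t in I k @^-1` E) (U k t + L *m X k t) i ord0 = 0.
Proof.
move=> mE; have := optimal_orthogonal k (invmx H *m delta_mx i ord0) mE.
have uH := posdef_unit (posdef_Rhat B g0 hR pP).
congr (_ = _); apply: eq_Rintegral => t _.
rewrite bl_mulr mulmxV // /bl mulmx1 mxE (bigD1 i) //= big1 => [|j ji].
  by rewrite [delta_mx _ _ _ _]mxE !eqxx mulr1 addr0 mxE.
by rewrite [delta_mx _ _ _ _]mxE (negbTE ji) mulr0.
Qed.

End optimality.

(** * Conditional expectations *)

Section conditional_expectation.
Context {d : measure_display} {T : measurableType d} {R : realType}.
Variable Pr : probability T R.
Context {dV : measure_display} {V : measurableType dV}.
Variable I : {mfun T >-> V}.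

(* Radon-Nikodym on the space of values of I, so that the density composed
   with I is measurable with respect to I. *)
Lemma factored_condexp (f : T -> R) : integrable1 Pr f ->
  exists h : V -> R, [/\ measurable_fun setT h, integrable1 Pr (h \o I)
    & forall E, measurable E ->
      (\int[Pr]_(t in I @^-1` E) (h (I t))%:E
       = \int[Pr]_(t in I @^-1` E) (f t)%:E)%E].
Proof.
move=> iF; have mI : measurable_fun setT I by [].
pose mu : probability V R := distribution Pr I.
pose nuF : {charge set V -> \bar R} := pushforward (induced_charge iF) I.
pose nu := nuF mI.
(* An event null for the law of I has a null preimage, over which f integrates to 0. *)
have numu : nu `<< mu.
  apply/null_content_dominatesP => E mE muE.
  have mS : measurable (I @^-1` E) by have := mI measurableT E mE; rewrite setTI.
  apply: null_set_integral => //.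
  by apply: measurable_funTS; exact: measurable_int iF.
pose rn := Radon_Nikodym nu mu.
have fin z : rn z \is a fin_num by exact: Radon_Nikodym_fin_num.
have rnE : EFin \o (fine \o rn) = rn by apply/funext => z /=; rewrite fineK.
have irn : mu.-integrable setT rn by exact: Radon_Nikodym_integrable.
have mrn : measurable_fun setT rn by exact: measurable_int irn.
have irnI : Pr.-integrable setT (rn \o I).
  apply/integrableP; split; first exact: measurableT_comp.
  have /integrableP[_] := irn; apply: le_lt_trans.
  rewrite ge0_integral_distribution //; exact: measurableT_comp.
have rnI : EFin \o ((fine \o rn) \o I) = rn \o I.
  by apply/funext => t /=; rewrite fineK.
exists (fine \o rn); split.
- by apply/measurable_EFinP; rewrite rnE.
- by rewrite /integrable1 rnI.
- move=> E mE.
  have mS : measurable (I @^-1` E) by have := mI measurableT E mE; rewrite setTI.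
  transitivity (\int[Pr]_(t in I @^-1` E) (rn \o I) t)%E.
    by apply: eq_integral => t _ /=; rewrite fineK.
  rewrite -integral_pushforward //; last exact: (integrableS measurableT).
  by rewrite -(Radon_Nikodym_integral numu mE).
Qed.

(** Measurability with respect to I makes the event f > 0 a preimage under I; the integrals over it
    and over the whole space determine the mean of |f|. *)
Lemma ae_eq0_of_preimage_integrals (f : T -> R) : integrable1 Pr f ->
  (forall D, measurable D -> g_sigma_algebra_preimage I (f @^-1` D)) ->
  (forall E, measurable E -> \int[Pr]_(t in I @^-1` E) f t = 0) ->
  {ae Pr, forall t, f t = 0}.
Proof.
move=> iF mf f0.
have [E mE] := mf `]0, +oo[%classic (measurable_itv _).
rewrite setTI => SE; set S := I @^-1` E in SE.
have mS : measurable S.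
  by have := @measurable_funPT _ _ _ _ I measurableT E mE; rewrite setTI.
have abs t : `|f t| = 2 * ((t \in S)%:R * f t) - f t.
  rewrite SE; case: (ltP 0 (f t)) => ft.
    by rewrite mem_set ?mul1r ?gtr0_norm ?mulr_natl //= ?in_itv /= ?ft //; ring.
  rewrite memNset ?mul0r ?mulr0 ?sub0r ?ler0_norm //= in_itv /= andbT.
  by apply/negP; rewrite -leNgt.
have iA : \int[Pr]_t `|f t| = 0.
  under eq_Rintegral do rewrite abs -mulN1r.
  rewrite RintegralT_D; [|by apply: integrable1Z; exact: integrable1_indic|
    exact: integrable1Z].
  rewrite !RintegralT_Z //; last exact: integrable1_indic.
  rewrite Rintegral_indicE f0 // -[setT](preimage_setT I) f0 //.
  by rewrite !mulr0 addr0.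
have : (\int[Pr]_t `|(f t)%:E| = 0)%E.
  have := EFin_Rintegral measurableT (integrable_norm iF).
  by rewrite /= iA => <-.
have mF : measurable_fun setT (fun t => (f t)%:E) by exact: measurable_int iF.
move/(ae_eq_integral_abs Pr measurableT mF).1.
by apply: filterS => t /(_ Logic.I) [].
Qed.

End conditional_expectation.

(** * From orthogonality to certainty equivalence *)

Section certainty_equivalence.
Context {d : measure_display} {T : measurableType d} {R : realType}.
Variable Pr : probability T R.
Context {nx nu : nat} {dV : measure_display} {V : measurableType dV}.
Variables (I : T -> V) (mI : measurable_fun setT I).
Variables (x : T -> 'cV[R]_nx).
Hypothesis hx : sq_integrable_vec Pr x.

Let G := g_sigma_algebra_preimage I.
HB.instance Definition _ := isMeasurableFun.Build _ _ _ _ I mI.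

Lemma condexp_exists : exists xhat, is_condexp Pr G x xhat.
Proof.
have ix i : integrable1 Pr (fun t => x t i ord0) := sq_integrable_integrable (hx i).
have hP i := factored_condexp I (ix i).
pose h i := sval (cid (hP i)).
have hE i : [/\ measurable_fun setT (h i), integrable1 Pr (h i \o I)
    & forall E, measurable E ->
      (\int[Pr]_(t in I @^-1` E) (h i (I t))%:E
       = \int[Pr]_(t in I @^-1` E) (x t i ord0)%:E)%E].
  by rewrite /h; case: cid.
pose hv z : 'cV[R]_nx := \col_i h i z.
exists (hv \o I); split=> [i|i|E mE|i S [E mE <-]]; first exact: ix.
- have [_ iH _] := hE i.
  by have -> : (fun w => ((hv \o I) w i ord0)%:E) = EFin \o (h i \o I);
    [apply/funext => t /=; rewrite mxE|].
- exists (hv @^-1` E); last by rewrite setTI.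
  have mhv : measurable_fun setT hv.
    apply: measurable_fun_matrix => i j; under eq_fun do rewrite mxE.
    by case: (hE i).
  by have := mhv measurableT E mE; rewrite setTI.
- rewrite setTI; have [_ _ <-//] := hE i.
  by apply: eq_integral => t _ /=; rewrite mxE.
Qed.

(** The sum of the control and L [xhat] is measurable with respect to I. On preimages under I it
    integrates as with x in place of [xhat], that is to 0, so it vanishes almost everywhere. *)
Lemma condexp_certainty_equivalence (mu : V -> 'cV[R]_nu) (L : 'M[R]_(nu, nx))
    (xhat : T -> 'cV[R]_nx) :
  measurable_fun setT mu -> sq_integrable_vec Pr (mu \o I) ->
  (forall E i, measurable E ->
     \int[Pr]_(t in I @^-1` E) (mu (I t) + L *m x t) i ord0 = 0) ->
  is_condexp Pr G x xhat ->
  {ae Pr, forall t, mu (I t) = - (L *m xhat t)}.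
Proof.
move=> mmu iU orth [ix ixh mxh condE].
pose f i t := (mu (I t) + L *m xhat t) i ord0.
have iu i : integrable1 Pr (fun t => mu (I t) i ord0) := sq_integrable_integrable (iU i).
have iLx (y : T -> 'cV[R]_nx) i : (forall j, integrable1 Pr (fun t => y t j ord0)) ->
    integrable1 Pr (fun t => (L *m y t) i ord0).
  move=> iy; under eq_fun do rewrite mxE.
  by apply: integrable1_sum => j; exact: integrable1Z.
have LE (y : T -> 'cV[R]_nx) i S : measurable S ->
    (forall j, integrable1 Pr (fun t => y t j ord0)) ->
    \int[Pr]_(t in S) (mu (I t) + L *m y t) i ord0
    = \int[Pr]_(t in S) mu (I t) i ord0
      + \sum_j L i j * \int[Pr]_(t in S) y t j ord0.
  move=> mS iy; have iS h : integrable1 Pr h -> Pr.-integrable S (EFin \o h).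
    by move=> ih; exact: (integrableS measurableT).
  under eq_Rintegral do rewrite mxE.
  rewrite (RintegralD mS (iS _ (iu i)) (iS _ (iLx y i iy))); congr (_ + _).
  under eq_Rintegral do rewrite mxE.
  rewrite Rintegral_sum_in // => [|j]; last exact: integrable1Z.
  by apply: eq_bigr => j _; rewrite RintegralZl //; exact: iS.
suff h i : {ae Pr, forall t, f i t = 0}.
  have : \forall t \ae Pr, forall i, f i t = 0 by exact: filter_forall.
  apply: filterS => t ft; apply/eqP; rewrite -addr_eq0; apply/eqP.
  by apply/matrixP => i j; rewrite ord1 [RHS]mxE -[RHS](ft i).
apply: (@ae_eq0_of_preimage_integrals _ _ _ Pr _ _ I).
- have -> : f i = (fun t => mu (I t) i ord0 + (L *m xhat t) i ord0).
    by apply/funext => t; rewrite /f mxE.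
  by apply: integrable1D => //; exact: iLx.
- have mf : measurable_fun setT (f i : g_sigma_algebra_preimageType I -> R).
    apply: (measurableT_comp (measurable_entry i ord0)).
    apply: measurable_addmx.
      apply: (measurableT_comp mmu) => _ E mE.
      by exists E.
    apply: measurable_mulmx_l => _ E mE; rewrite setTI; exact: mxh.
  by move=> D mD; have := mf measurableT D mD; rewrite setTI.
- move=> E mE; have mS : measurable (I @^-1` E).
    by have := mI measurableT mE; rewrite setTI.
  rewrite LE // -[RHS](orth E i mE) LE //; congr (_ + _).
  apply: eq_bigr => j _; congr (_ * _); rewrite /Rintegral condE //.
  by exists E => //; rewrite setTI.
Qed.

End certainty_equivalence.

Theorem mainTheorem1 (d : measure_display) (T : measurableType d)
    (R : realType) (Pr : probability T R) (nx nu : nat)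
    (A : 'M[R]_nx) (B : 'M[R]_(nx, nu))
    (x0 : {RV Pr >-> 'cV[R]_nx}) (W : nat -> {RV Pr >-> 'cV[R]_nx})
    (K0 KW : 'M[R]_nx)
    (hx0 : centered_with_covariance Pr x0 K0)
    (hW : forall k, centered_with_covariance Pr (W k) KW)
    (hind : mutually_independent Pr
      (fun o : option nat => if o is Some k then W k : T -> 'cV[R]_nx else x0))
    (Q Qh : 'M[R]_nx) (Rc : 'M[R]_nu) (gamma lambda : R)
    (hQ : psd Q) (hR : posdef Rc) (hlambda : 0 < lambda)
    (hgamma : 0 < gamma < 1)
    (hAB : controllable A B)
    (hQh : psd_sqrt_of Qh Q) (hAQ : observable A Qh)
    (mc : cpolicy R nx nu) (ms : spolicy R nx nu)
    (hopt : optimal_pair Pr A B Q Rc gamma lambda x0 W mc ms) :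
  exists P : 'M[R]_nx,
    [/\ psd P, riccati gamma A B Q Rc P,
        forall P' : 'M[R]_nx, psd P' -> riccati gamma A B Q Rc P' -> P' = P
      & forall k : nat,
          let xk w := state A B mc ms (x0 w) (W ^~ w) k in
          let Ik w := cinfo_at A B mc ms (x0 w) (W ^~ w) k in
          (exists xhat, is_condexp Pr (g_sigma_algebra_preimage Ik) xk xhat) /\
          (forall xhat, is_condexp Pr (g_sigma_algebra_preimage Ik) xk xhat ->
             {ae Pr, forall w,
                mc k (Ik w)
                = - (gamma *: (invmx (Rhat gamma B Rc P) *m B^T *m P *m A
                                 *m xhat w))})].
Proof.
case: hopt => hmc hms hJ.
have pP := psd_riccati_sol hgamma hR hQ hAB.
have rP := riccati_solP hgamma hR hQ hAB.
exists (riccati_sol gamma A B Q Rc); split=> // [P' pP' rP'|k].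
  exact: (riccati_unique hgamma hR hQ hQh hAQ pP rP).
have Jfin : (J Pr A B Q Rc gamma lambda x0 (fun k => W k) mc ms < +oo)%E.
  have [mc0 [ms0 [hmc0 hms0]]] :=
    finite_cost_pair hQ hR hlambda hgamma hx0 hW hAB.
  by apply: le_lt_trans; exact: hJ.
have [_ _ _ mI] := loop_measurable A B x0 W hmc hms k.
have sx := sq_integrable_state hQ hR hlambda hgamma hx0 hW hmc hms Jfin k.
have su := sq_integrable_control hQ hR hlambda hgamma hmc hms Jfin k.
split; first exact: (condexp_exists mI sx).
move=> xhat hxhat.
have uE : loop_u A B x0 W mc ms k = mc k \o loop_I A B x0 W mc ms k.
  by apply/funext => t; exact: controlE.
rewrite uE in su.
have := condexp_certainty_equivalence (L := gain gamma A B Rc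
  (riccati_sol gamma A B Q Rc)) mI (hmc k) su _ hxhat.
have orth E i : measurable E -> \int[Pr]_(t in loop_I A B x0 W mc ms k @^-1` E)
    (mc k (loop_I A B x0 W mc ms k t)
     + gain gamma A B Rc (riccati_sol gamma A B Q Rc)
       *m loop_x A B x0 W mc ms k t) i ord0 = 0.
  move=> mE.
  have := optimal_mean hQ hR hlambda hgamma hQh hAQ hx0 hW hind hmc hms Jfin
    pP rP hJ k i mE.
  by under eq_Rintegral do rewrite /loop_u controlE.
move=> /(_ orth); apply: filterS => t ->.
by rewrite /gain -scalemxAl.
Qed.
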